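(* Consider the system described in the context with infinite battery capacity, mean harvested energy per slot $\bar A$, $p_c\in(0,1]$, $v>0$, and $E_u:[0,R]\to[0,\infty)$ continuous and increasing. Let $$\bar E_u=\int_0^R E_u(d)\tfrac{2d}{R^2}\,\mathrm{d}d,\qquad C=C_{\mathrm{thr,EE}}=\min\Big\{N,\Big\lfloor\Big(\frac{Np_u\bar E_u}{p_cE_p\sum_{j=1}^N j^{-v}}\Big)^{1/v}\Big\rfloor\Big\},$$ $$\eta=\Big(1-\frac{p_cC}{N+p_c}\Big)p_u\Big(1-\sum_{i=1}^{C}f_i\Big).$$ Let $\tilde d\in[0,R]$ be the largest value with $$\int_0^{\tilde d}E_u(d)\tfrac{2d}{R^2}\,\mathrm{d}d\le\min\Big\{\bar E_u,\ \tfrac1\eta\max\Big\{0,\bar A-\tfrac{p_cCE_p}{N+p_c}\Big\}\Big\}.$$ Under the energy-efficient threshold-based (EETB) policy, the SBS acts as follows in slot $k$: - if $C_k<C$: it pushes when $E_k\ge E_p$, and sleeps otherwise; - if $C_k\ge C$: it unicasts the requested content when there is a request (necessarily for a content of rank $>C_k$) with unicast energy $Q_k$ satisfying $0<Q_k\le\min\{E_u(\tilde d),E_k\}$, and sleeps otherwise. If $\bar A\ge \frac{p_cCE_p}{N+p_c}$, the blocking probability of the EETB policy is $$p_{\mathrm{blk,EE}}=\frac{p_cp_uC}{N+p_c}\Big(1-\sum_{i=1}^{C}f_i\Big)+\eta\,\frac{R^2-\tilde d^2}{R^2}.$$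
   Context: Time is slotted. There are $N$ contents ranked $c_1,\dots,c_N$, and rank $i$ has popularity $f_i=\frac{i^{-v}}{\sum_{j=1}^N j^{-v}}$. Popularity dynamics: in each slot, with probability $p_c$, a uniformly chosen content is removed; the contents below it move up one rank, and a new content enters at rank $N$. Push state and actions: users store $c_1,\dots,c_{C_k}$ ($C_k\in\{0,\dots,N\}$). In each slot the SBS chooses sleep (cost $0$), unicast to the current requester at distance $d$ (cost $E_u(d)$), or push (cost $E_p$, sends $c_{C_k+1}$ to all users). The energy used must not exceed the battery level $E_k$. Transitions of $C_k$: - without push: $C_{k+1}=C_k-1$ with probability $p_cC_k/N$, else $C_k$; - with push: $C_{k+1}=C_k$ with probability $p_cC_k/N$, else $C_k+1$. Requests: each slot, independently, with probability $p_u$ there is a request, for $c_i$ with probability $f_i$, from a location uniform in the disk of radius $R$ around the SBS. The quantity $Q_k=E_u(d)$ denotes the unicast energy of the current request ($Q_k=0$ if there is no request). A request is blocked if its content has rank $>C_k$ and it is neither unicast nor pushed in that slot. The blocking probability is the long-run fraction of slots with a blocked request. Energy: the battery evolves as $E_{k+1}=E_k-U_k+A_k$ (infinite capacity), where $U_k$ is the energy used in slot $k$ and the harvested energies $A_k$ are i.i.d. with mean $\bar A$. *)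

(* Defs.v *)
From Stdlib Require List.
From HB Require Import structures.
From mathcomp Require Import all_boot all_order all_algebra.
From mathcomp Require Import all_classical all_reals all_analysis.
Unset Strict Implicit. Unset Printing Implicit Defensive.
Import Order.TTheory GRing.Theory Num.Theory.
Import numFieldNormedType.Exports.
Local Open Scope classical_set_scope.
Local Open Scope ring_scope.

Definition mutually_independent {d} {T : measurableType d} {R : realType}
  (P : probability T R) {I : Type} (G : I -> set (set T)) : Prop :=
  forall (J : seq I) (A : I -> set T),
    (forall i, Stdlib.Lists.List.In i J -> G i (A i)) ->
    Stdlib.Lists.List.NoDup J ->
    P (\bigcap_(i in [set i | Stdlib.Lists.List.In i J]) A i) = (\prod_(i <- J) P (A i))%E.

Definition disc_events {T S : Type} (X : T -> S) : set (set T) :=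
  [set X @^-1` B | B in [set: set S]].
Definition real_events {d} {T : measurableType d} {R : realType}
  (X : T -> R) : set (set T) :=
  [set X @^-1` B | B in [set B : set R | measurable B]].

Inductive slot_var := VRem | VRemIdx | VReq | VRank | VDist | VHarv.

Definition slot_events {d} {T : measurableType d} {R : realType} (N : nat)
  (Brem : nat -> T -> bool) (Urem : nat -> T -> 'I_N)
  (Req : nat -> T -> bool) (Rank : nat -> T -> 'I_N)
  (Dist : nat -> T -> R) (A : nat -> T -> R) (kv : nat * slot_var)
  : set (set T) :=
  match kv.2 with
  | VRem => disc_events (Brem kv.1)
  | VRemIdx => disc_events (Urem kv.1)
  | VReq => disc_events (Req kv.1)
  | VRank => disc_events (Rank kv.1)
  | VDist => real_events (Dist kv.1)
  | VHarv => real_events (A kv.1)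
  end.

Section Model.
Variable R : realType.

(* popularity of the content of rank i+1 (0-based index i : 'I_N) *)
Definition zipf_sum (N : nat) (v : R) : R :=
  \sum_(j < N) (j.+1%:R) `^ (- v).
Definition popularity (N : nat) (v : R) (i : 'I_N) : R :=
  (i.+1%:R) `^ (- v) / zipf_sum N v.
Definition pop_head (N : nat) (v : R) (C : nat) : R :=
  \sum_(i < N | (i < C)%N) popularity N v i.

Definition partial_unicast_energy (Eu : R -> R) (Rad x : R) : R :=
  (\int[lebesgue_measure]_(d in `[0, x]) (Eu d * (2 * d / Rad ^+ 2)))%R.
Definition mean_unicast_energy (Eu : R -> R) (Rad : R) : R :=
  partial_unicast_energy Eu Rad Rad.

Definition C_thr_EE (N : nat) (v pc pu Ep Ebar : R) : nat :=
  minn N (Num.truncn ((N%:R * pu * Ebar / (pc * Ep * zipf_sum N v)) `^ (1 / v))).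

Definition eta_EE (N : nat) (v pc pu : R) (C : nat) : R :=
  (1 - pc * C%:R / (N%:R + pc)) * pu * (1 - pop_head N v C).

(* right-hand side of the inequality defining tilde d; when eta = 0 the
   term (1/eta) max{...} is read as +oo (the min is then Ebar_u) *)
Definition dtilde_bound (N : nat) (v pc pu Ep Ebar Abar : R) (C : nat) : R :=
  let eta := eta_EE N v pc pu C in
  if eta == 0 then Ebar
  else Num.min Ebar (eta^-1 * Num.max 0 (Abar - pc * C%:R * Ep / (N%:R + pc))).

Inductive action := Sleep | Unicast | Push.
Definition is_unicast (a : action) : bool :=
  if a is Unicast then true else false.
Definition is_push (a : action) : bool :=
  if a is Push then true else false.

(* c = C_k, e = E_k, req = request present, rank = 0-based rank of the
   requested content, q = Q_k = E_u(distance) *)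
Definition eetb_action (N C : nat) (Ep Eud : R) (c : nat) (e : R)
  (req : bool) (rank : 'I_N) (q : R) : action :=
  if (c < C)%N then (if Ep <= e then Push else Sleep)
  else if [&& req, (c <= rank)%N, 0 < q, q <= Eud & q <= e] then Unicast
  else Sleep.

Definition energy_used (Ep q : R) (a : action) : R :=
  match a with Sleep => 0 | Unicast => q | Push => Ep end.

(* a stored content is removed: removal happens and the uniformly chosen
   removed content (0-based rank u) is among the c stored ones;
   this has probability p_c c / N *)
Definition drop (brem : bool) (N : nat) (u : 'I_N) (c : nat) : nat :=
  (brem && (u < c)%N : nat).

Definition next_C (a : action) (c dr : nat) : nat :=
  match a with Push => c.+1 - dr | _ => c - dr end.

Fixpoint eetb_state (N C : nat) (Ep Eud : R) (Eu : R -> R) (C0 : nat) (E0 : R)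
  (brem : nat -> bool) (urem : nat -> 'I_N) (req : nat -> bool)
  (rank : nat -> 'I_N) (dist : nat -> R) (harv : nat -> R) (k : nat)
  : nat * R :=
  match k with
  | 0 => (C0, E0)
  | k'.+1 =>
    let s := eetb_state N C Ep Eud Eu C0 E0 brem urem req rank dist harv k' in
    let a := eetb_action N C Ep Eud s.1 s.2 (req k') (rank k') (Eu (dist k')) in
    (next_C a s.1 (drop (brem k') N (urem k') s.1),
     s.2 - energy_used Ep (Eu (dist k')) a + harv k')
  end.

Definition eetb_blocked (N C : nat) (Ep Eud : R) (Eu : R -> R) (C0 : nat) (E0 : R)
  (brem : nat -> bool) (urem : nat -> 'I_N) (req : nat -> bool)
  (rank : nat -> 'I_N) (dist : nat -> R) (harv : nat -> R) (k : nat) : bool :=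
  let s := eetb_state N C Ep Eud Eu C0 E0 brem urem req rank dist harv k in
  let a := eetb_action N C Ep Eud s.1 s.2 (req k) (rank k) (Eu (dist k)) in
  [&& req k, (s.1 <= rank k)%N, ~~ is_unicast a
    & ~~ (is_push a && (val (rank k) == s.1))].

End Model.

(* Main.v *)
(* A sample path is treated deterministically once countably many laws of large
   numbers hold on it: in slots selected by the state, which depends only on
   the past, the frequency of an event about the current inputs tends to its
   probability.  Such centred indicators are orthogonal and bounded, so their means
   converge almost surely along the squares, hence along all integers.  Harvested
   energies are only bounded below, by truncated step functions, which avoids the
   strong law for integrable variables.

   On a path, call a slot deficient if the battery is too low for the action wanted
   by the policy.  Counting pushes against removals gives at most
   pi K - pc S / (N + pc) + o(K) pushes in K slots, where pi = pc C / (N + pc) and S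
   counts the slots left without a push; as one push costs at least the mean unicast
   energy per slot (by the choice of C), the battery at time K is at least a positive
   multiple of the deficit minus o(K).  Deficits occur only when the battery is
   bounded, so they are o(K), even in the critical case where the mean harvest equals
   the mean consumption.  Then C_k = C - 1 with frequency pi and C_k = C otherwise,
   and the blocked requests can be counted. *)

Require Import Defs.
From HB Require Import structures.
From mathcomp Require Import all_boot all_order all_algebra.
From mathcomp Require Import all_classical all_reals all_analysis.
From mathcomp Require Import measurable_realfun ring lra zify.
Import Order.TTheory GRing.Theory Num.Theory.
Import numFieldNormedType.Exports.
Local Open Scope classical_set_scope.
Local Open Scope ring_scope.

Set Implicit Arguments.
Unset Strict Implicit.
Unset Printing Implicit Defensive.

(** * Negligible sequences and the sample-path argument *)

Section Negligible.
Context {R : realType}.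
Implicit Types f g : nat -> R.

(* One-sided little-o of the partial sums; the constant [c] stands for "eventually",
   which keeps the notion usable in inductions on [K]. *)
Definition negl f := forall e, 0 < e ->
  exists c, forall K, \sum_(k < K) f k <= e * K%:R + c.

Lemma negl_le f g : (forall k, f k <= g k) -> negl g -> negl f.
Proof.
move=> fg hg e e0; have [c hc] := hg e e0; exists c => K.
by apply: le_trans (hc K); apply: ler_sum => i _; exact: fg.
Qed.

Lemma neglD f g : negl f -> negl g -> negl (fun k => f k + g k).
Proof.
move=> hf hg e e0; have e20 : 0 < e / 2 by lra.
have [c hc] := hf _ e20; have [c' hc'] := hg _ e20.
exists (c + c') => K; rewrite big_split /=.
by have := lerD (hc K) (hc' K); lra.
Qed.

Lemma neglZ a f : 0 <= a -> negl f -> negl (fun k => a * f k).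
Proof.
move=> a0 hf e e0; have a1 : 0 < a + 1 by lra.
(* Dividing by [a + 1] rather than [a] covers [a = 0]. *)
have [c hc] := hf (e / (a + 1)) (divr_gt0 e0 a1).
exists (a * c) => K; rewrite -mulr_sumr.
apply: le_trans (ler_wpM2l a0 (hc K)) _.
rewrite mulrDr lerD2r mulrA; apply: ler_wpM2r => //.
rewrite mulrA ler_pdivrMr //; nra.
Qed.

Lemma negl_bounded f c : (forall K, \sum_(k < K) f k <= c) -> negl f.
Proof.
move=> hf e e0; exists c => K; apply: le_trans (hf K) _.
by rewrite lerDr mulr_ge0 // ltW.
Qed.

(** Permits a fixed error per slot, as left by the truncations, step functions and Riemann sums
    below. *)
Lemma negl_eps f : (forall e, 0 < e -> negl (fun k => f k - e)) -> negl f.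
Proof.
move=> hf e e0; have e20 : 0 < e / 2 by lra.
have [c hc] := hf _ e20 _ e20; exists c => K.
have := hc K; rewrite sumrB sumr_const card_ord -mulr_natr; lra.
Qed.

Lemma negl_sum {I : Type} (r : seq I) (F : I -> nat -> R) :
  (forall i, negl (F i)) -> negl (fun k => \sum_(i <- r) F i k).
Proof.
move=> hF; elim: r => [|i r IH].
  by apply: (@negl_bounded _ 0) => K; rewrite big1// => k _; rewrite big_nil.
apply: (@negl_le _ (fun k => F i k + \sum_(j <- r) F j k)).
  by move=> k; rewrite big_cons.
exact: neglD.
Qed.

(** [negl] only bounds the upper limit of the means by zero, so a limit needs it on both sides. *)
Lemma negl_cvg_mean f t : negl (fun k => f k - t) -> negl (fun k => t - f k) ->
  (fun K : nat => K%:R^-1 * \sum_(k < K) f k) @ \oo --> t.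
Proof.
move=> hu hl; apply/cvgrPdist_le => e e0.
have e20 : 0 < e / 2 by lra.
have [c hc] := hu _ e20; have [c' hc'] := hl _ e20.
near=> K.
have K0 : 0 < K%:R :> R by rewrite ltr0n; near: K; exact: nbhs_infty_gt.
have HK : (`|c| + `|c'|) / (e / 2) <= K%:R by near: K; exact: nbhs_infty_ger.
rewrite ler_pdivrMr // in HK.
have -> : t - K%:R^-1 * \sum_(k < K) f k =
   K%:R^-1 * (K%:R * t - \sum_(k < K) f k).
  by rewrite mulrBr mulrA mulVf ?mul1r// gt_eqF.
rewrite normrM gtr0_norm ?invr_gt0// mulrC ler_pdivrMr // ler_norml.
have := hc K; have := hc' K; rewrite !sumrB sumr_const card_ord -mulr_natr.
have := ler_norm c; have := ler_norm c'.
have := normr_ge0 c; have := normr_ge0 c'.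
move=> ? ? ? ? ? ?; apply/andP; split; nra.
Unshelve. all: by end_near. Qed.

(* [z] only grows at times when [e] lies below [M]; looking back from the last
   such time, [sum z] is at most [M] plus the negligible error. *)
Lemma negl_reflected (z e : nat -> R) (M M' : R) : 0 <= M -> 0 <= M' ->
  (forall k, z k = 0 \/ e k < M /\ z k <= M') ->
  negl (fun k => z k - (e k.+1 - e k)) -> negl z.
Proof.
move=> M0 M'0 hz hd eps eps0; have [c hc] := hd _ eps0.
have tel K : \sum_(k < K) (e k.+1 - e k) = e K - e 0%N.
  by rewrite -(big_mkord xpredT (fun k => e k.+1 - e k)) telescope_sumr.
exists (`|c| + `|e 0%N| + M + M'); elim => [|K IH].
  by rewrite big_ord0; have := normr_ge0 c; have := normr_ge0 (e 0%N); lra.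
rewrite big_ord_recr /=; case: (hz K) => [-> | [eK zK]].
  rewrite addr0; apply: le_trans IH _; rewrite -(addn1 K) natrD; lra.
have := hc K; rewrite sumrB tel -(addn1 K) natrD.
have := ler_norm c; have := ler_norm (- e 0%N); rewrite normrN; lra.
Qed.

End Negligible.

(** * Deterministic analysis of one sample path *)

Section Path.
Context {R : realType}.
Variables (N C : nat) (Ep Eud : R) (Eu : R -> R) (C0 : nat) (E0 : R).
Variables (brem : nat -> bool) (urem : nat -> 'I_N) (req : nat -> bool).
Variables (rank : nat -> 'I_N) (dist : nat -> R) (harv : nat -> R).

Let st := eetb_state R N C Ep Eud Eu C0 E0 brem urem req rank dist harv.
Let blk := eetb_blocked R N C Ep Eud Eu C0 E0 brem urem req rank dist harv.
Let c k := (st k).1.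
Let e k := (st k).2.
Let q k := Eu (dist k).
Let dr k := Defs.drop (brem k) N (urem k) (c k).
Let push k := ((c k < C)%N && (Ep <= e k)).
Let starve k := ((c k < C)%N && (e k < Ep)).
Let high k := (C <= c k)%N.
Let over k := (C < c k)%N.
Let under k := (((c k).+1 < C)%N && (Ep <= e k)).
Let asked k := (req k && (C <= rank k)%N).
Let near k := (asked k && (q k <= Eud)).
Let denied k := [&& high k, near k & e k < q k].

Hypothesis hN : (0 < N)%N.
Hypothesis hC : (C <= N)%N.
Hypothesis hC0 : (C0 <= N)%N.
Hypothesis q0 : forall k, 0 < q k.

Lemma dr_le k : (dr k <= 1)%N.
Proof. by rewrite /dr /Defs.drop; case: (_ && _). Qed.

Lemma dr_le_stored k : (dr k <= c k)%N.
Proof. by rewrite /dr /Defs.drop; case: brem => //=; case: ltnP => //; lia. Qed.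

Lemma stored_next k : c k.+1 = if push k then ((c k).+1 - dr k)%N else (c k - dr k)%N.
Proof.
rewrite /c /= -/st /eetb_action /push -/(c k) -/(e k).
case: ltnP => /= _; last by case: ifP.
by case: ifP.
Qed.

Lemma battery_next k : e k.+1 = e k + harv k - Ep * (push k)%:R -
  q k * [&& high k, req k, (c k <= rank k)%N, q k <= Eud & q k <= e k]%:R.
Proof.
rewrite /e /= -/st /eetb_action /push /high -/(c k) -/(e k) -/(q k) q0 /=.
case: ltnP => /= _; first by case: ifP => _ /=; rewrite ?mulr1 ?mulr0; lra.
by case: ifP => _ /=; rewrite ?mulr1 ?mulr0; lra.
Qed.

Lemma stored_le k : (c k <= N)%N.
Proof.
elim: k => [//|k IH]; rewrite stored_next /push.
case: (ltnP (c k) C) => lt_cC; last exact: leq_trans (leq_subr _ _) IH.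
case: ifP => _; apply: leq_trans (leq_subr _ _) _ => //.
exact: leq_trans lt_cC hC.
Qed.

(** No push takes place from level [C] on, so the excess [c k - C] (truncated subtraction) never
    grows, and a removal of a stored content above [C] lowers it by one. *)
Lemma over_drop k : (over k * dr k + (c k.+1 - C) <= c k - C)%N.
Proof.
rewrite stored_next /push /over; have := dr_le k.
by case: (ltnP (c k) C) => hc; [case: ifP | ]; case: (ltnP C) => //=; lia.
Qed.

(** The gap [C.-1 - c k], also truncated, shrinks by one at a push below [C.-1] unless a removal
    cancels it, and only a starving slot can widen it. It is measured from [C.-1] because a removal
    at level [C] leads there, where the gap is still zero. *)
Lemma under_push k :
  (C.-1 - c k.+1 + under k <= C.-1 - c k + starve k + under k * dr k)%N.
Proof.
have := dr_le k; have := dr_le_stored k.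
rewrite stored_next /push /under /starve ltNge.
case: ltnP => hc; case: ltnP => hc'; case: (_ <= e k) => //=; lia.
Qed.

Lemma sum_over_drop K :
  (\sum_(k < K) over k * dr k + (c K - C) <= c 0 - C)%N.
Proof.
elim: K => [|K IH]; first by rewrite big_ord0.
rewrite big_ord_recr /= -addnA; apply: leq_trans IH.
by rewrite leq_add2l; exact: over_drop.
Qed.

Lemma sum_under_push K : (C.-1 - c K + \sum_(k < K) under k <=
  C.-1 - c 0 + (\sum_(k < K) under k * dr k + \sum_(k < K) starve k))%N.
Proof.
elim: K => [|K IH]; first by rewrite !big_ord0.
rewrite !big_ord_recr /=; move: IH (under_push K).
by move: (\sum_(i < K) _)%N (\sum_(i < K) _)%N (\sum_(i < K) _)%N => x y z; lia.
Qed.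

(** In the application [h] is the popularity beyond the first [C] ranks, [m] the partial unicast
    energy up to [dt], and [p2] the share of the disk within [dt]. Thus [G] is the mean unicast
    energy wanted in a slot with at least [C] stored contents, and [pi_] the target frequency of
    pushes. *)
Variables (pc pu h m p2 Abar : R).
Hypothesis hpc : 0 < pc <= 1.
Hypothesis hEp : 0 < Ep.
Hypothesis hpu : 0 <= pu.
Hypothesis hh : 0 <= h.
Hypothesis p2_ge0 : 0 <= p2.
Hypothesis p2_le1 : p2 <= 1.
Hypothesis hEud : 0 <= Eud.
Hypothesis hm : 0 <= m.
Let G := pu * h * m.
Let pi_ := pc * C%:R / (N%:R + pc).
Hypothesis hGEp : G <= Ep.
Hypothesis hbudget : Ep * pi_ + (1 - pi_) * G <= Abar.

Let r (b : bool) : R := b%:R.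
Let mdr k : R := pc * (c k)%:R / N%:R.

Hypothesis lln_over : negl (fun k => r (over k) * (mdr k - (dr k)%:R)).
Hypothesis lln_under : negl (fun k => r (under k) * ((dr k)%:R - mdr k)).
Hypothesis lln_drop : negl (fun k => (dr k)%:R - mdr k).
Hypothesis lln_drop' : negl (fun k => mdr k - (dr k)%:R).
Hypothesis lln_push : negl (fun k => r (push k) * (r (asked k) - pu * h)).
Hypothesis lln_push' : negl (fun k => r (push k) * (pu * h - r (asked k))).
Hypothesis lln_high : negl (fun k => r (high k) * (r (asked k) - pu * h)).
Hypothesis lln_high' : negl (fun k => r (high k) * (pu * h - r (asked k))).
Hypothesis lln_near : negl (fun k => r (high k) * (r (near k) - pu * h * p2)).
Hypothesis lln_near' : negl (fun k => r (high k) * (pu * h * p2 - r (near k))).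
Hypothesis lln_energy : negl (fun k => r (high k) * (r (near k) * q k - G)).
Hypothesis lln_small : forall eps, 0 < eps -> exists2 del, 0 < del &
  negl (fun k => r (high k) * r (near k && (q k < del)) - eps).
Hypothesis lln_harv : negl (fun k => Abar - harv k).

Let pc0 : 0 < pc. Proof. by case/andP: hpc. Qed.
Let pc1 : pc <= 1. Proof. by case/andP: hpc. Qed.
Let N0 : 0 < N%:R :> R. Proof. by rewrite ltr0n. Qed.
Let N0' : 0 <= N%:R :> R. Proof. exact: ltW. Qed.

Let mdrE k : mdr k * N%:R = pc * (c k)%:R.
Proof. by rewrite /mdr mulfVK // gt_eqF. Qed.

Lemma stored_nextR k :
  (c k.+1)%:R = (c k)%:R + r (push k) - (dr k)%:R :> R.
Proof.
have hk := dr_le_stored k; rewrite stored_next /r.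
case: push; rewrite ?addr0 natrB //; last exact: leqW.
by rewrite -addn1 natrD.
Qed.

Lemma sum_push_drop K :
  \sum_(k < K) (r (push k) - (dr k)%:R) = (c K)%:R - (c 0)%:R.
Proof.
rewrite -(telescope_sumr (fun k => (c k)%:R)) // big_mkord.
by apply: eq_bigr => i _; rewrite stored_nextR; lra.
Qed.

Let cN k : (c k)%:R <= N%:R :> R. Proof. by rewrite ler_nat stored_le. Qed.
Let c_0 k : 0 <= (c k)%:R :> R. Proof. exact: ler0n. Qed.

Lemma negl_push_drop : negl (fun k => r (push k) - (dr k)%:R).
Proof.
apply: (@negl_bounded _ _ N%:R) => K; rewrite sum_push_drop.
by have := cN K; have := c_0 0; lra.
Qed.

Lemma negl_drop_push : negl (fun k => (dr k)%:R - r (push k)).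
Proof.
apply: (@negl_bounded _ _ N%:R) => K.
have := sum_push_drop K; rewrite !sumrB.
by have := cN 0; have := c_0 K; lra.
Qed.

(** The excess is at most [N] at the start, so at most [N] slots above [C] see a removal of a stored
    content. Since [mdr k >= pc / N] in each such slot, the slots themselves are negligible. *)
Lemma negl_over : negl (fun k => r (over k)).
Proof.
have h1 : negl (fun k => r (over k) * (dr k)%:R).
  apply: (@negl_bounded _ _ N%:R) => K.
  have : (\sum_(k < K) over k * dr k <= N)%N.
    apply: leq_trans (stored_le 0); apply: leq_trans (leq_subr C (c 0)).
    by apply: leq_trans (sum_over_drop K); exact: leq_addr.
  rewrite -(ler_nat R) natr_sum => hs; apply: le_trans hs.
  by apply: ler_sum => i _; rewrite natrM.
have h2 := @neglZ _ (N%:R / pc) _ _ (neglD lln_over h1).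
apply: negl_le (h2 _); last by rewrite divr_ge0 // ltW.
move=> k; rewrite -mulrDr subrK /r /over; case: ltnP => // hc; rewrite ?mul0r ?mulr0 // mul1r.
have -> : N%:R / pc * mdr k = (c k)%:R.
  by rewrite /mdr; field; rewrite !gt_eqF //; lra.
by rewrite ler1n (leq_ltn_trans _ hc).
Qed.

Let Npc : 0 < N%:R + pc. Proof. exact: addr_gt0. Qed.

(** Pushes balance removals, so [N * push] matches [pc * c k] on average. It remains to use
    [c k + push + starve <= C + N * over] in every slot: a slot with a push or a starvation has
    level at most [C - 1]. *)
Lemma negl_push : negl (fun k =>
  r (push k) + pc / (N%:R + pc) * r (starve k) - pi_).
Proof.
have h1 := neglD (neglZ N0' negl_push_drop) (neglZ N0' lln_drop).
have Npc0 : 0 <= pc * N%:R by apply: mulr_ge0; exact: ltW.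
have h2 := neglD h1 (neglZ Npc0 negl_over).
have iNpc : 0 <= (N%:R + pc)^-1 by rewrite invr_ge0 ltW.
apply: negl_le (neglZ iNpc h2) => k.
have -> : r (push k) + pc / (N%:R + pc) * r (starve k) - pi_ =
  (N%:R + pc)^-1 * ((N%:R + pc) * r (push k) + pc * r (starve k) - pc * C%:R).
  by rewrite /pi_; field; rewrite gt_eqF.
apply: ler_wpM2l => //.
have := mdrE k => mk.
suff : pc * (r (push k) + r (starve k) + (c k)%:R) <= pc * (C%:R + N%:R * r (over k)).
  by nra.
apply: ler_wpM2l; first exact: ltW.
rewrite /push /starve /over /r; have := cN k.
case: (ltnP (c k) C) => hc /=.
  rewrite ltNge; case: (Ep <= e k) => /=; rewrite (ltnNge C) (ltnW hc) /=;
  move: hc; rewrite -(ler_nat R) -addn1 natrD; lra.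
case: ltnP => hC' /=; first by have := ler0n R C; lra.
by move: hC'; rewrite -(ler_nat R); lra.
Qed.

Let slot_split k : r (high k) = 1 - r (push k) - r (starve k).
Proof.
rewrite /high /push /starve /r ltNge; case: ltnP => _ /=; last lra.
by case: (_ <= _) => /=; lra.
Qed.

(** The energy saved per starving slot. With [high = 1 - push - starve] the mean consumption is at
    most [(Ep - G) * push + G - G * starve], and [negl_push] turns the first term into a further
    saving. The push term keeps [kap] positive when [G = 0]. *)
Let kap := (Ep - G) * (pc / (N%:R + pc)) + G.

Let G0 : 0 <= G. Proof. by rewrite /G !mulr_ge0. Qed.

Let kap0 : 0 < kap.
Proof.
rewrite /kap; have k0 : 0 < pc / (N%:R + pc) by exact: divr_gt0.
have [->|Gp] := eqVneq G 0; first by rewrite subr0 addr0 mulr_gt0.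
have : 0 < G by rewrite lt_neqAle eq_sym Gp.
have : 0 <= (Ep - G) * (pc / (N%:R + pc)) by rewrite mulr_ge0 ?subr_ge0 // ltW.
lra.
Qed.

Let deficit k := kap * r (starve k) + r (denied k) * q k.

(* A deficit keeps in the battery the energy that would have been used, so the
   budget inequality turns deficits into growth of the battery; but a deficit
   can only occur while the battery is low. *)
Lemma negl_deficit : negl deficit.
Proof.
(* A starving slot has [e k < Ep], a denied one [e k < q k <= Eud]; the deficit never exceeds
   [kap + Eud]. *)
apply: (@negl_reflected _ _ e (Num.max Ep Eud) (kap + Eud)).
- by rewrite le_max ltW.
- by rewrite addr_ge0 // ltW.
- move=> k; rewrite /deficit /starve /denied /near /high /r.
  case: (ltnP (c k) C) => hc /=; last first.
    rewrite mulr0 add0r; case: asked; rewrite /= ?mul0r; last by left.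
    case: (leP (q k) Eud) => hq; rewrite /= ?mul0r; last by left.
    case: ltP => he; rewrite /= ?mul0r; last by left.
    right; rewrite lt_max (lt_le_trans he hq) orbT mul1r.
    by split=> //; have := kap0; lra.
  rewrite mul0r addr0; case: ltP => he; rewrite /= ?mulr0; last by left.
  by right; rewrite lt_max he mulr1 lerDl.
have EG : 0 <= Ep - G by rewrite subr_ge0.
have h1 := neglD lln_harv (neglD lln_energy (neglZ EG negl_push)).
apply: negl_le h1 => k.
(* A unicast and a denial exclude each other and both need a near request, so [lln_energy] bounds
   the energy spent and the energy denied together. *)
have hU : q k * (r [&& high k, req k, (c k <= rank k)%N, q k <= Eud & q k <= e k] +
   r (denied k)) <= q k * (r (high k) * r (near k)).
  apply: ler_wpM2l; first exact: ltW.
  rewrite /denied /near /asked /high /r; case: (leqP C (c k)) => hc //=; last by lra.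
  case: (req k) => /=; last by lra.
  case: (leqP (c k)) => hr /=.
    rewrite (leq_trans hc hr) /= ltNge; case: (_ <= Eud) => /=; last by lra.
    by case: (_ <= e k) => /=; lra.
  by rewrite mul1r add0r ler_nat; case: (C <= rank k)%N; case: (q k <= Eud); case: (e k < q k).
have := hbudget; have pE := battery_next k; have sp := slot_split k.
rewrite /deficit /kap /r in sp hU *; nra.
Qed.

Lemma negl_starve : negl (fun k => r (starve k)).
Proof.
have k0 : 0 <= kap^-1 by rewrite invr_ge0 ltW.
apply: negl_le (neglZ k0 negl_deficit) => k.
rewrite /deficit mulrDr mulrA mulVf ?gt_eqF // mul1r lerDl.
by rewrite !mulr_ge0 // ltW.
Qed.

(** [negl_deficit] bounds the denied energy, not the number of denials. Denials costing at least
    [del] number at most the denied energy over [del]; cheaper requests are rare by [lln_small]. *)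
Lemma negl_denied : negl (fun k => r (denied k)).
Proof.
apply: negl_eps => eps eps0; have [del del0 hd] := lln_small eps0.
have d0 : 0 <= del^-1 by rewrite invr_ge0 ltW.
apply: (negl_le _ (neglD (neglZ d0 negl_deficit) hd)) => k.
rewrite addrA lerD2r /deficit /denied /r.
have [hq|hq] := leP del (q k).
  rewrite andbF mulr0 addr0 mulrC ler_pdivlMr //.
  have : 0 <= kap * (starve k)%:R by rewrite mulr_ge0 // ltW.
  by case: (_ && _) => /=; lra.
rewrite andbT; have : 0 <= del^-1 *
    (kap * (starve k)%:R + [&& high k, near k & e k < q k]%:R * q k).
  by rewrite mulr_ge0 // addr_ge0 // mulr_ge0 // ltW.
by case: high; case: near; case: (_ < q k) => /=; lra.
Qed.

(** By [sum_under_push], the [under] slots without a removal are at most as many as the starving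
    slots, up to a constant. As [c k + 2 <= N] in an [under] slot, a removal there has probability
    bounded away from one, so all [under] slots are negligible. *)
Lemma negl_under : negl (fun k => r (under k)).
Proof.
have h1 : negl (fun k => r (under k) - r (under k) * (dr k)%:R - r (starve k)).
  apply: (@negl_bounded _ _ N%:R) => K.
  have : (\sum_(k < K) under k <= N +
    (\sum_(k < K) under k * dr k + \sum_(k < K) starve k))%N.
    apply: leq_trans (leq_addl (C.-1 - c K) _) _.
    apply: leq_trans (sum_under_push K) _; rewrite leq_add2r.
    by apply: leq_trans (leq_subr _ _) (leq_trans (leq_pred _) hC).
  rewrite -(ler_nat R) !natrD !natr_sum !sumrB => hs.
  have -> : \sum_(k < K) r (under k) * (dr k)%:R = \sum_(k < K) (under k * dr k)%:R.
    by apply: eq_bigr => i _; rewrite natrM.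
  by rewrite /r; lra.
have h2 := neglD (neglD h1 negl_starve) lln_under.
apply: (negl_le _ (neglZ N0' h2)) => k.
rewrite subrK mulrBr addrA subrK.
rewrite /r /under; case: ltnP => hc /=; last by lra.
case: (Ep <= e k) => /=; last by lra.
rewrite !mul1r mulrBr mulr1 [N%:R * mdr k]mulrC mdrE.
have : ((c k).+1)%:R + 1 <= N%:R :> R by rewrite natr1 ler_nat (leq_trans hc hC).
rewrite -addn1 natrD; have := c_0 k; have := pc0; have := pc1; nra.
Qed.

(** Same balance as in [negl_push], now with [C <= c k + push + N * (starve + under)]: outside the
    two error events the level is at least [C], or equals [C - 1] and a push occurs. *)
Lemma negl_push' : negl (fun k => pi_ - r (push k)).
Proof.
have h1 := neglD (neglZ N0' negl_drop_push) (neglZ N0' lln_drop').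
have Npc0 : 0 <= pc * N%:R by apply: mulr_ge0; exact: ltW.
have h2 := neglD h1 (neglZ Npc0 (neglD negl_starve negl_under)).
have iNpc : 0 <= (N%:R + pc)^-1 by rewrite invr_ge0 ltW.
apply: negl_le (neglZ iNpc h2) => k.
have -> : pi_ - r (push k) = (N%:R + pc)^-1 * (pc * C%:R - (N%:R + pc) * r (push k)).
  by rewrite /pi_; field; rewrite gt_eqF.
apply: ler_wpM2l => //; have := mdrE k => mk.
suff : pc * C%:R <= pc * ((c k)%:R + r (push k) + N%:R * (r (starve k) + r (under k))).
  by nra.
apply: ler_wpM2l; first exact: ltW.
have CN : C%:R <= N%:R :> R by rewrite ler_nat.
have := c_0 k; rewrite /push /under /starve /r ltNge.
case: (ltnP (c k) C) => hc /=; last first.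
  by rewrite (ltnNge (c k).+1) (leqW hc) /= => _; move: hc; rewrite -(ler_nat R); lra.
case: (Ep <= e k) => /=; last by rewrite andbF /=; lra.
case: ltnP => hC' /=; first by lra.
by move: hC'; rewrite -(ler_nat R) -addn1 natrD; lra.
Qed.

(** The first two terms describe the regular slots: level [C - 1] with a push, and level [C] with
    enough energy for near requests. Every other slot is charged to an error event. *)
Lemma blocked_le k : r (blk k) <=
  r (push k) * r (asked k) + r (high k) * (r (asked k) - r (near k)) +
  (r (starve k) + r (under k) + r (over k) + r (denied k)).
Proof.
rewrite /blk /eetb_blocked -/st -/(c k) -/(e k) -/(q k).
rewrite /push /high /starve /under /over /denied /near /asked /eetb_action /high /near /asked.
rewrite q0 /r !ltNge; case: (req k) => /=; last first.
  by rewrite !andbF !mulr0 subrr mulr0 !addr0 !addr_ge0.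
case: (ltngtP (c k) C) => hc /=.
- case: (_ <= e k) => /=; last by case: (_ <= _)%N => //=; rewrite ?andbF /=; lra.
  case: (ltnP (c k).+1 C) => h1 /=.
    by case: (_ && _); case: (_ <= rank k)%N => /=; lra.
  (* At level [C - 1] the pushed content has 0-based rank [C - 1], so a request for it is served and
     only ranks from [C] on are blocked. *)
  have -> : C = (c k).+1 by apply/eqP; rewrite eqn_leq h1.
  by case: ltngtP => /=; lra.
- apply: (@le_trans _ _ 1); first by rewrite lern1 leq_b1.
  move: (_ && (Ep <= e k)) (~~ (q k <= e k)) => u w.
  have := ler0n R u; have := ler0n R w.
  by case: (C <= rank k)%N; case: (q k <= Eud) => /=; lra.
rewrite hc ltnNge leqnSn /=; case: (_ <= rank k)%N => /=; last by lra.
by case: (_ <= Eud); case: (_ <= e k) => /=; lra.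
Qed.

(** Below [C], a request of rank at least [C] is neither stored nor pushed. Only above [C] may it be
    stored already, whence the correction [over]. *)
Lemma blocked_ge k :
  r (push k) * r (asked k) + r (high k) * (r (asked k) - r (near k))
  <= r (blk k) + r (over k).
Proof.
rewrite /blk /eetb_blocked -/st -/(c k) -/(e k) -/(q k).
rewrite /push /high /over /near /asked /eetb_action.
rewrite q0 /r; case: (req k) => /=; last by rewrite !mulr0 subrr mulr0 !add0r.
case: (ltngtP (c k) C) => hc /=.
- case: (leqP C) => hr /=; last by case: (_ <= e k) => /=; case: (_ && _) => /=; lra.
  case: (_ <= e k) => /=; last by case: (_ && _) => /=; lra.
  have hr' := leq_trans hc hr; rewrite (ltnW hr') gtn_eqF //=; lra.
- apply: (@le_trans _ _ 1); last by rewrite lerDr ler0n.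
  by case: (C <= rank k)%N; case: (q k <= Eud) => /=; lra.
rewrite hc; case: (_ <= rank k)%N => /=; last by lra.
by case: (_ <= Eud); case: (_ <= e k) => /=; lra.
Qed.

Theorem blocking_frequency :
  (fun K : nat => K%:R^-1 * \sum_(k < K) (blk k)%:R) @ \oo -->
    pi_ * (pu * h) + (1 - pi_) * (pu * h) * (1 - p2).
Proof.
have uh : 0 <= pu * h by rewrite mulr_ge0.
(* Eliminating [high] leaves [push] with the nonnegative coefficient [pu * h * p2], so [negl_push]
   serves the upper bound and [negl_push'] the lower one. *)
have uhp : 0 <= pu * h * p2 by rewrite mulr_ge0 ?subr_ge0.
have uhq : 0 <= pu * h * (1 - p2) by rewrite mulr_ge0 ?subr_ge0.
apply: (@negl_cvg_mean R (fun k => r (blk k))).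
  have h1 := neglD (neglD (neglD negl_starve negl_under) negl_over) negl_denied.
  have h2 := neglD h1 (neglD (neglD lln_push lln_high) lln_near').
  have h3 := neglD h2 (neglZ uhp negl_push).
  apply: negl_le h3 => k; have := blocked_le k; have := slot_split k.
  have s0 : 0 <= r (starve k) by rewrite /r.
  have k0 : 0 <= pc / (N%:R + pc) by rewrite divr_ge0 // ltW.
  have t0 : 0 <= pu * h * (1 - p2) * r (starve k) by rewrite mulr_ge0.
  have t1 : 0 <= pu * h * p2 * (pc / (N%:R + pc) * r (starve k)).
    by rewrite mulr_ge0 // mulr_ge0.
  move=> ->; rewrite -/(r (blk k)); nra.
have h1 := neglD negl_over (neglD (neglD lln_push' lln_high') lln_near).
have h2 := neglD h1 (neglD (neglZ uhp negl_push') (neglZ uhq negl_starve)).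
apply: negl_le h2 => k; have := blocked_ge k; have := slot_split k.
move=> ->; rewrite -/(r (blk k)); nra.
Qed.

End Path.

(** * Strong law for bounded orthogonal sequences *)

Section OrthogonalLLN.
Context {R : realType} {d : measure_display} {T : measurableType d}.
Variable P : probability T R.
Implicit Types f g : T -> R.

Definition bounded_measurable f :=
  measurable_fun setT f /\ exists M, forall w, `|f w| <= M.

Lemma bounded_measurable_cst a : bounded_measurable (cst a).
Proof. by split; [exact: measurable_cst | exists `|a|]. Qed.

Lemma bounded_measurableD f g : bounded_measurable f -> bounded_measurable g ->
  bounded_measurable (fun w => f w + g w).
Proof.
move=> [mf [M hM]] [mg [M' hM']]; split; first exact: measurable_funD.
by exists (M + M') => w; apply: le_trans (ler_normD _ _) _; exact: lerD.
Qed.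

Lemma bounded_measurableM f g : bounded_measurable f -> bounded_measurable g ->
  bounded_measurable (fun w => f w * g w).
Proof.
move=> [mf [M hM]] [mg [M' hM']]; split; first exact: measurable_funM.
exists (M * M') => w; rewrite normrM; apply: ler_pM => //.
Qed.

Lemma bounded_measurable_sum n (X : nat -> T -> R) :
  (forall k, bounded_measurable (X k)) ->
  bounded_measurable (fun w => \sum_(k < n) X k w).
Proof.
move=> hX; elim: n => [|n IH].
  by under eq_fun do rewrite big_ord0; exact: bounded_measurable_cst.
by under eq_fun do rewrite big_ord_recr /=; exact: bounded_measurableD.
Qed.

Lemma bounded_measurable_indic (A : set T) : measurable A ->
  bounded_measurable \1_A.
Proof.
move=> mA; split; first exact: measurable_indic.
by exists 1 => w; rewrite indicE normr_nat lern1 leq_b1.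
Qed.

Lemma bounded_measurable_integrable f : bounded_measurable f ->
  P.-integrable setT (EFin \o f).
Proof.
move=> [mf [M hM]]; apply: measurable_bounded_integrable => //.
  by apply: le_lt_trans (probability_le1 P measurableT) _; rewrite ltry.
exists M; split; first exact: num_real.
by move=> y My w _ /=; apply: le_trans (hM w) (ltW My).
Qed.

Let E f : R := \int[P]_w f w.

Lemma RintegralT_D f g : bounded_measurable f -> bounded_measurable g ->
  E (fun w => f w + g w) = E f + E g.
Proof.
by move=> hf hg; apply: RintegralD => //; exact: bounded_measurable_integrable.
Qed.

Lemma RintegralT_Z a f : bounded_measurable f -> E (fun w => a * f w) = a * E f.
Proof.
by move=> hf; apply: RintegralZl => //; exact: bounded_measurable_integrable.
Qed.

Lemma Rintegral_indic (A : set T) : measurable A -> E \1_A = fine (P A).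
Proof. by move=> mA; rewrite /E /Rintegral integral_indic // setIT. Qed.

Variable X : nat -> T -> R.
Hypothesis mX : forall k, measurable_fun setT (X k).
Hypothesis X_le1 : forall k w, `|X k w| <= 1.
Hypothesis X_orth : forall i j, (i < j)%N -> E (fun w => X i w * X j w) = 0.

Let bX k : bounded_measurable (X k).
Proof. by split => //; exists 1. Qed.

Let S n w := \sum_(k < n) X k w.

Lemma second_moment_sum n : E (fun w => S n w ^+ 2) <= n%:R.
Proof.
have bS m : bounded_measurable (S m) by exact: bounded_measurable_sum.
have orth k m : (m <= k)%N -> E (fun w => S m w * X k w) = 0.
  elim: m => [|m IH] mk.
    have -> : (fun w => S 0 w * X k w) = cst 0.
      by apply/funext => w; rewrite /S big_ord0 mul0r.
    by rewrite /E Rintegral_cst // mul0r.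
  have -> : (fun w => S m.+1 w * X k w) =
      (fun w => S m w * X k w + X m w * X k w).
    by apply/funext => w; rewrite /S big_ord_recr /= mulrDl.
  by rewrite RintegralT_D ?IH ?X_orth ?addr0 // ?(ltnW mk) //;
    exact: bounded_measurableM.
elim: n => [|n IH].
  have -> : (fun w => S 0 w ^+ 2) = cst 0.
    by apply/funext => w; rewrite /S big_ord0 expr0n.
  by rewrite /E Rintegral_cst // mul0r.
have -> : (fun w => S n.+1 w ^+ 2) =
    (fun w => S n w * S n w + (2 * (S n w * X n w) + X n w * X n w)).
  by apply/funext => w; rewrite /S big_ord_recr /=; ring.
rewrite RintegralT_D; last 2 first.
- exact: bounded_measurableM.
- apply: bounded_measurableD; last exact: bounded_measurableM.
  apply: bounded_measurableM; first exact: bounded_measurable_cst.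
  exact: bounded_measurableM.
rewrite RintegralT_D; last 2 first.
- apply: bounded_measurableM; first exact: bounded_measurable_cst.
  exact: bounded_measurableM.
- exact: bounded_measurableM.
rewrite RintegralT_Z; last exact: bounded_measurableM.
rewrite orth // mulr0 add0r -addn1 natrD; apply: lerD.
  by under eq_fun do rewrite -expr2; exact: IH.
have <- : E (cst 1) = 1.
  rewrite /E Rintegral_cst // mul1r -[RHS]/(fine 1%E); congr fine.
  exact: probability_setT.
apply: le_Rintegral => //.
- by apply: bounded_measurable_integrable; exact: bounded_measurableM.
- by apply: bounded_measurable_integrable; exact: bounded_measurable_cst.
- move=> w _ /=; apply: le_trans (ler_norm _) _; rewrite normrM.
  by apply: mulr_ile1.
Qed.

Let Z n w : R := (S (n.+1 ^ 2) w / (n.+1 ^ 2)%:R) ^+ 2.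

Lemma sum_inv_sq (n : nat) :
  \sum_(k < n.+1) ((k.+1 ^ 2)%:R)^-1 <= 2 - (n.+1%:R)^-1 :> R.
Proof.
elim: n => [|n IH]; first by rewrite big_ord1 /= exp1n invr1; lra.
rewrite big_ord_recr /=; apply: le_trans (lerD IH (lexx _)) _.
have n0 : 0 < n.+1%:R :> R by rewrite ltr0n.
rewrite -[n.+2]addn1 natrX natrD; set x := n.+1%:R in n0 *.
have -> : 2 - x^-1 + ((x + 1) ^+ 2)^-1 = 2 - (x + 1)^-1 - (x * (x + 1) ^+ 2)^-1.
  by field; rewrite !gt_eqF //; lra.
by rewrite lerBlDr lerDl invr_ge0 mulr_ge0 ?exprn_ge0 //; lra.
Qed.

(** Along squares the second moments of the means are at most [1 / n ^ 2], hence summable. The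
    series of squared means [Z] is then integrable, so finite almost everywhere, and its terms tend
    to zero. The shift in [Z] avoids division by zero. *)
Lemma square_means_cvg0 :
  {ae P, forall w, (fun n => S (n ^ 2) w / (n ^ 2)%:R) @ \oo --> (0 : R)}.
Proof.
have bZ n : bounded_measurable (Z n).
  rewrite /Z; under eq_fun do rewrite expr2.
  by apply: bounded_measurableM; apply: bounded_measurableM;
    [exact: bounded_measurable_sum | exact: bounded_measurable_cst
    |exact: bounded_measurable_sum | exact: bounded_measurable_cst].
have Z0 n w : 0 <= Z n w by exact: sqr_ge0.
have mZ n : measurable_fun setT (fun w => (Z n w)%:E).
  by apply/measurable_EFinP; case: (bZ n).
have EZ n : (\int[P]_w (Z n w)%:E <= (((n.+1 ^ 2)%:R)^-1)%:E)%E.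
  have n0 : 0 < (n.+1 ^ 2)%:R :> R by rewrite ltr0n expn_gt0.
  have -> : (\int[P]_w (Z n w)%:E)%E = (E (Z n))%:E.
    rewrite /E /Rintegral fineK //.
    exact: (integrable_fin_num _ (bounded_measurable_integrable (bZ n))).
  rewrite lee_fin.
  have -> : Z n = fun w => (((n.+1 ^ 2)%:R)^-1 ^+ 2) * (S (n.+1 ^ 2) w ^+ 2).
    by apply/funext => w; rewrite /Z exprMn mulrC.
  rewrite RintegralT_Z; last first.
    under eq_fun do rewrite expr2.
    by apply: bounded_measurableM; exact: bounded_measurable_sum.
  rewrite expr2 -mulrA ger_pMr ?invr_gt0 // mulrC ler_pdivrMr // mul1r.
  exact: second_moment_sum.
have fin : (\int[P]_w (\sum_(0 <= n <oo) (Z n w)%:E) < +oo)%E.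
  rewrite integral_nneseries //; last by move=> n w _; rewrite lee_fin.
  apply: (@le_lt_trans _ _ (2%:E)); last by rewrite ltry.
  apply: lime_le.
    by apply: is_cvg_nneseries => n _ _; apply: integral_ge0 => w _; rewrite lee_fin.
  near=> n; have n0 : (0 < n)%N by near: n; exact: nbhs_infty_gt.
  rewrite big_mkord.
  apply: (@le_trans _ _ (\sum_(k < n) (((k.+1 ^ 2)%:R)^-1)%:E)%E).
    by apply: lee_sum => k _; exact: EZ.
  rewrite sumEFin lee_fin -(prednK n0); apply: le_trans (sum_inv_sq _) _.
  by rewrite gerBl invr_ge0.
have mser : measurable_fun setT (fun w => \sum_(0 <= n <oo) (Z n w)%:E)%E.
  by apply: ge0_emeasurable_sum => // n w _ _; rewrite lee_fin.
have int : P.-integrable setT (fun w => \sum_(0 <= n <oo) (Z n w)%:E)%E.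
  apply/integrableP; split => //; apply: le_lt_trans fin.
  rewrite (eq_integral (fun w => \sum_(0 <= n <oo) (Z n w)%:E)%E) // => w _.
  by rewrite gee0_abs // nneseries_ge0 // => n _ _; rewrite lee_fin.
apply: filterS (integrable_ae measurableT int) => w /(_ I) hw.
have hZ : (fun n => Z n w) @ \oo --> (0 : R).
  apply: cvg_series_cvg_0; apply: nondecreasing_is_cvgn.
    by apply: nondecreasing_series => n _ _; exact: Z0.
  exists (fine (\sum_(0 <= n <oo) (Z n w)%:E)%E) => _ [n _ <-].
  rewrite -lee_fin fineK // /series /= -sumEFin.
  by apply: nneseries_lim_ge => k _ _; rewrite lee_fin.
rewrite -(cvg_shiftS _) /=.
apply/cvgrPdist_le => e e0; near=> n.
rewrite sub0r normrN -(ler_pXn2r (n := 2)) ?nnegrE ?(ltW e0) // real_normK ?num_real //.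
near: n; move/cvgrPdist_le: hZ => /(_ (e ^+ 2) (exprn_gt0 _ e0)).
by apply: filterS => n; rewrite sub0r normrN ger0_norm.
Unshelve. all: by end_near. Qed.

(** From [n ^ 2] up to any [K < n.+1 ^ 2] the sum moves by at most [2 n], which is absorbed by
    [2 n <= e / 2 * n ^ 2 + 2 / e]. *)
Lemma orthogonal_lln : {ae P, forall w, negl (fun k => X k w)}.
Proof.
apply: filterS square_means_cvg0 => w hw e e0.
have e20 : 0 < e / 2 by lra.
have /cvgrPdist_le /(_ _ e20) [n0 _ hn] := hw.
have bnd K : S K w <= K%:R.
  rewrite /S; apply: le_trans (_ : \sum_(k < K) (1 : R) <= _).
    by apply: ler_sum => k _; apply: le_trans (ler_norm _) (X_le1 _ _).
  by rewrite sumr_const card_ord.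
(* [n0 ^ 2] covers the times before the means along squares become small; [2 / e] comes from the
   inequality for [2 n]. *)
exists ((n0 ^ 2)%:R + 2 / e) => K.
have sqr : exists n, (n ^ 2 <= K < n.+1 ^ 2)%N.
  have ex : exists n, (n ^ 2 <= K)%N by exists 0%N.
  have ub n : (n ^ 2 <= K)%N -> (n <= K)%N by move=> h; nia.
  case: (ex_maxnP ex ub) => n nK mn; exists n; rewrite nK /= ltnNge.
  by apply/negP => /mn; rewrite ltnn.
have [n /andP[nK Kn]] := sqr.
have hS : S (n ^ 2) w <= e / 2 * (n ^ 2)%:R + (n0 ^ 2)%:R.
  have [nn|nn] := leqP n0 n.
    have := hn _ nn; rewrite /= sub0r normrN => h.
    have [->|npos] := posnP n; first by rewrite /S big_ord0 mulr0 add0r.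
    rewrite normrM [`|_^-1|]gtr0_norm ?invr_gt0 ?ltr0n ?expn_gt0 ?npos // in h.
    rewrite ler_pdivrMr ?ltr0n ?expn_gt0 ?npos // in h.
    apply: le_trans (ler_norm _) _; apply: le_trans h _; by rewrite lerDl.
  apply: le_trans (bnd _) _; rewrite -[X in X <= _]add0r; apply: lerD.
    by rewrite mulr_ge0 // ltW.
  by rewrite ler_nat leq_exp2r // ltnW.
have hK : S K w <= S (n ^ 2) w + n%:R *+ 2.
  rewrite /S -(subnKC nK) big_split_ord /=; apply: lerD => //.
  apply: le_trans (_ : \sum_(k < K - n ^ 2) (1 : R) <= _).
    by apply: ler_sum => k _; apply: le_trans (ler_norm _) (X_le1 _ _).
  rewrite sumr_const card_ord -mulrnA ler_nat; nia.
have am : n%:R *+ 2 <= e / 2 * (n ^ 2)%:R + 2 / e.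
  rewrite natrX -mulr_natr -subr_ge0.
  have -> : e / 2 * n%:R ^+ 2 + 2 / e - n%:R * 2 = e / 2 * (n%:R - 2 / e) ^+ 2.
    by field; rewrite gt_eqF.
  by rewrite mulr_ge0 ?sqr_ge0 // ltW.
apply: le_trans hK _; apply: le_trans (lerD hS am) _.
by rewrite addrACA -mulrDl -splitr lerD2r ler_wpM2l ?ler_nat // ltW.
Qed.

End OrthogonalLLN.

(** * Independence of the past and the current slot *)

Section PastSlot.
Context {R : realType} {d : measure_display} {T : measurableType d}.
Variable P : probability T R.
Variable G : nat * slot_var -> set (set T).
Hypothesis G_T : forall i, G i setT.
Hypothesis G_I : forall i A B, G i A -> G i B -> G i (A `&` B).
Hypothesis G_m : forall i A, G i A -> measurable A.
Hypothesis G_indep : mutually_independent P G.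

(** Only rectangles, which are stable under intersection; the history before slot [n] is the
    generated sigma-algebra [<<s past n>>]. *)
Definition past n : set (set T) :=
  [set F | exists2 A, (forall i, G i (A i)) &
     F = [set w | forall i, (i.1 < n)%N -> A i w]].

Definition slot n : set (set T) :=
  [set H | exists2 B, (forall v, G (n, v) (B v)) & H = [set w | forall v, B v w]].

Let slot_idx (n : nat) := [:: (n, VRem); (n, VRemIdx); (n, VReq); (n, VRank); (n, VDist);
  (n, VHarv)].
Fixpoint past_idx n :=
  if n is n'.+1 then past_idx n' ++ slot_idx n' else [::].

Let In_slot n i : List.In i (slot_idx n) <-> i.1 = n.
Proof.
case: i => m v /=; split; last by move=> ->; case: v; intuition.
by do 6 (case=> [[-> _] //|]).
Qed.

Let In_past n i : List.In i (past_idx n) <-> (i.1 < n)%N.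
Proof.
elim: n => [//|n IH] /=; rewrite (List.in_app_iff (past_idx n)) IH In_slot.
rewrite ltnS [(i.1 <= n)%N]leq_eqVlt.
split=> [[->|/eqP ->]|/orP[/eqP|]]; rewrite ?orbT //; [by right|by left].
Qed.

Let NoDup_slot n : List.NoDup (slot_idx n).
Proof. by repeat constructor; rewrite /= ; intuition discriminate. Qed.

Let NoDup_past n : List.NoDup (past_idx n).
Proof.
elim: n => [|n IH] /=; first exact: List.NoDup_nil.
apply: List.NoDup_app => // i; rewrite In_past In_slot => /[swap] ->.
by rewrite ltnn.
Qed.

Lemma slot_prob n (B : slot_var -> set T) : (forall v, G (n, v) (B v)) ->
  P [set w | forall v, B v w] =
    (P (B VRem) * P (B VRemIdx) * P (B VReq) * P (B VRank) * P (B VDist) *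
     P (B VHarv))%E.
Proof.
move=> hB; have := G_indep (J := slot_idx n) (A := fun i => B i.2).
have -> : \bigcap_(i in [set i | List.In i (slot_idx n)]) B i.2 =
    [set w | forall v, B v w].
  apply/seteqP; split => w /= h; last by move=> i _; exact: h.
  by move=> v; apply: (h (n, v)); apply/In_slot.
move=> ->; first by rewrite !big_cons big_nil /= mule1 !muleA.
  by case=> m v /In_slot /= ->; exact: hB.
exact: NoDup_slot.
Qed.

Lemma past_slot_indep n F H : past n F -> slot n H -> P (F `&` H) = (P F * P H)%E.
Proof.
move=> [A hA ->] [B hB ->].
(* One family for both events, so that independence can be applied to the indices of the past, of
   the slot, and of their concatenation. *)
pose D i := if (i.1 < n)%N then A i else if i.1 == n then B i.2 else setT.
have hD i : G i (D i).
  rewrite /D; case: ifP => // _; case: eqP => //; case: i => m v /= ->; exact: hB.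
have E J : List.NoDup J -> P (\bigcap_(i in [set i | List.In i J]) D i) =
    (\prod_(i <- J) P (D i))%E by move=> nd; apply: G_indep => // i _.
have -> : [set w | forall i, (i.1 < n)%N -> A i w] =
    \bigcap_(i in [set i | List.In i (past_idx n)]) D i.
  apply/seteqP; split => w /= h i /=.
    by move=> /In_past hi; rewrite /D hi; exact: h.
  by move=> hi; have /In_past := hi; move=> /h; rewrite /D hi.
have -> : [set w | forall v, B v w] =
    \bigcap_(i in [set i | List.In i (slot_idx n)]) D i.
  apply/seteqP; split => w /= h => [i /= /In_slot hi|v].
    by rewrite /D hi ltnn eqxx.
  by have /In_slot /h := erefl (n, v).1; rewrite /D /= ltnn eqxx.
rewrite -bigcap_setU.
have -> : [set i | List.In i (past_idx n)] `|` [set i | List.In i (slot_idx n)] =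
    [set i | List.In i (past_idx n.+1)].
  by apply/seteqP; split => i /=; rewrite (List.in_app_iff (past_idx n)).
by rewrite !E // big_cat.
Qed.

Lemma past_T n : past n setT.
Proof. by exists (fun=> setT) => //; apply/seteqP; split. Qed.

Lemma past_I n : setI_closed (past n).
Proof.
move=> _ _ [A hA ->] [B hB ->]; exists (fun i => A i `&` B i) => [i|].
  exact: G_I.
apply/seteqP; split => w /= => [[h h'] i hi|h]; first by split; auto.
by split => i /h [].
Qed.

Lemma past_gen n i A : (i.1 < n)%N -> G i A -> <<s past n>> A.
Proof.
move=> hi hA; apply: sub_sigma_algebra.
(* This is [A] at index [i] and the whole space at every other index. *)
exists (fun j => [set w | j = i -> A w]).
  move=> j; have [->|ji] := pselect (j = i).
    by have -> : [set w | i = i -> A w] = A by apply/seteqP; split => w /=; auto.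
  have -> : [set w | j = i -> A w] = setT; last exact: G_T.
  by apply/seteqP; split => // w _ /= /ji.
apply/seteqP; split => w /=; first by move=> ? j _ _.
by move=> /(_ i hi erefl).
Qed.

Lemma past_measurable n F : <<s past n>> F -> measurable F.
Proof.
move: F; rewrite -/(_ `<=` measurable).
apply: smallest_sub; first exact: sigma_algebra_measurable.
move=> _ [A hA ->].
rewrite (_ : mkset _ = \bigcap_(i in [set i : nat * slot_var | List.In i (past_idx n)]) A i).
  elim: (past_idx n) => [|i J IH].
    by rewrite (_ : mkset _ = set0) ?bigcap_set0.
  rewrite (_ : mkset _ = [set i] `|` [set j | List.In j J]).
    by rewrite bigcap_setU bigcap_set1; apply: measurableI => //; exact: G_m (hA i).
  by apply/seteqP; split => j /= [->|?]; [left|right|left|right].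
by apply/seteqP; split => w /= h i /=; [move/In_past/h | move=> /In_past; exact: h].
Qed.

Lemma slot_past n H : slot n H -> <<s past n.+1>> H.
Proof.
move=> [B hB ->]; apply: sub_sigma_algebra.
exists (fun i => if i.1 == n then B i.2 else setT).
  by case=> m v /=; case: eqP => // ->.
apply/seteqP; split => w /=; first by move=> h [m v] /= _; case: eqP.
by move=> h v; have := h (n, v); rewrite /= ltnSn eqxx; exact.
Qed.

Lemma past_mono m n F : (m <= n)%N -> <<s past m>> F -> <<s past n>> F.
Proof.
move=> mn; move: F; apply: sub_sigma_algebra2 => _ [A hA ->].
exists (fun i => if (i.1 < m)%N then A i else setT).
  by move=> i; case: ifP.
apply/seteqP; split => w /= h i hi; first by case: ifP => // /h.
by have := h i; rewrite hi; apply; exact: leq_trans mn.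
Qed.

Lemma slot_measurable n H : slot n H -> measurable H.
Proof. by move=> /slot_past /past_measurable. Qed.

(** Rectangles form a pi-system, and the events independent of the fixed [H] form a Dynkin class. *)
Lemma sigma_past_slot_indep n F H : <<s past n>> F -> slot n H ->
  P (F `&` H) = (P F * P H)%E.
Proof.
move=> + sH; have mH := slot_measurable sH.
have fH : P H \is a fin_num by exact: fin_num_measure.
have PH : (P H <= 1)%E by exact: probability_le1.
apply: (@dynkin_induction _ (g_sigma_algebraType (past n)) (past n)
  (fun F => P (F `&` H) = (P F * P H)%E)).
- by [].
- exact: past_I.
- by rewrite setTI probability_setT mul1e.
- by move=> A pA; exact: (past_slot_indep pA sH).
- move=> A /past_measurable mA AH.
  have fA : P A \is a fin_num by exact: fin_num_measure.
  rewrite (setIC (~` A) H) -setDE measureD //; last by apply: le_lt_trans PH _; rewrite ltry.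
  rewrite [X in (_ - X)%E](_ : _ = (P A * P H)%E); last first.
    by rewrite (setIC H A); exact: AH.
  rewrite probability_setC // muleBl ?mul1e //.
- move=> A mA tA hA; have mA' k : @measurable d T (A k) by apply: (@past_measurable n); exact: mA.
  rewrite setI_bigcupl measure_bigcup //; last first.
  + by apply: trivIset_setIr.
  + by move=> k _; exact: measurableI.
  rewrite (measure_bigcup P setT) //.
  rewrite muleC -(fineK fH) -nneseriesZl //.
  by apply: eq_eseriesr => k _; rewrite (fineK fH) [RHS]muleC; exact: hA.
Qed.

(** * Law of large numbers in slots selected by the past *)

Section PredictableLLN.
Variables (F H : nat -> set T) (p : R).
Hypothesis F_past : forall k, <<s past k>> (F k).
Hypothesis H_slot : forall k, slot k (H k).
Hypothesis H_prob : forall k, P (H k) = p%:E.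

Let p01 : 0 <= p <= 1.
Proof.
have := probability_le1 P (slot_measurable (H_slot 0)).
by rewrite H_prob lee_fin => ->; rewrite andbT -lee_fin -(H_prob 0) measure_ge0.
Qed.

Let mF k : measurable (F k). Proof. exact: past_measurable (@F_past k). Qed.
Let mH k : measurable (H k). Proof. exact: slot_measurable (H_slot k). Qed.

Lemma Rintegral_past_slot k A : <<s past k>> A ->
  \int[P]_w (\1_A w * (\1_(H k) w - p)) = 0.
Proof.
move=> pA; have mA := past_measurable pA.
have -> : (fun w => \1_A w * (\1_(H k) w - p)) =
    (fun w => \1_(A `&` H k) w + - p * \1_A w).
  by apply/funext => w; rewrite indicI /=; ring.
rewrite RintegralT_D; last 2 first.
- by apply: bounded_measurable_indic; exact: measurableI.
- apply: bounded_measurableM; first exact: bounded_measurable_cst.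
  exact: bounded_measurable_indic.
rewrite RintegralT_Z; last exact: bounded_measurable_indic.
rewrite !Rintegral_indic //; last exact: measurableI.
rewrite (sigma_past_slot_indep pA) // H_prob fineM //; last exact: fin_num_measure.
by rewrite /= mulrC mulNr subrr.
Qed.

Lemma predictable_lln : {ae P, forall w,
  negl (fun k => \1_(F k) w * (\1_(H k) w - p)) /\
  negl (fun k => \1_(F k) w * (p - \1_(H k) w))}.
Proof.
pose X k w : R := \1_(F k) w * (\1_(H k) w - p).
have i01 (A : set T) w : 0 <= (\1_A w : R) <= 1 by rewrite indicE ler0n lern1 leq_b1.
have bX k : bounded_measurable (X k).
  apply: bounded_measurableM; first exact: bounded_measurable_indic.
  apply: bounded_measurableD; last exact: bounded_measurable_cst.
  exact: bounded_measurable_indic.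
have mX k : measurable_fun setT (X k) by case: (bX k).
have X1 k w : `|X k w| <= 1.
  rewrite normrM; apply: mulr_ile1 => //.
    by case/andP: (i01 (F k) w) => ? ?; rewrite ger0_norm.
  by rewrite ler_norml; have := i01 (H k) w; have := p01; lra.
have orth i j : (i < j)%N -> \int[P]_w (X i w * X j w) = 0.
  move=> ij.
  have pA : <<s past j>> (F i `&` F j).
    apply: (@measurableI _ (g_sigma_algebraType (past j))); last exact: (@F_past j).
    exact: past_mono (ltnW ij) (@F_past i).
  have pB : <<s past j>> ((F i `&` F j) `&` H i).
    apply: (@measurableI _ (g_sigma_algebraType (past j))) => //.
    exact: past_mono ij (slot_past (H_slot i)).
  (* For [i < j], both [X i] and the indicator of [F j] are known before slot [j]; expanding them
     leaves past indicators times the centred indicator of [H j]. *)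
  have -> : (fun w => X i w * X j w) =
      (fun w => \1_((F i `&` F j) `&` H i) w * (\1_(H j) w - p) +
         - p * (\1_(F i `&` F j) w * (\1_(H j) w - p))).
    by apply/funext => w; rewrite /X !indicI /=; ring.
  have bM A : <<s past j>> A ->
      bounded_measurable (fun w => \1_A w * (\1_(H j) w - p)).
    move=> pC; apply: bounded_measurableM.
      by apply: bounded_measurable_indic; exact: past_measurable pC.
    apply: bounded_measurableD; last exact: bounded_measurable_cst.
    exact: bounded_measurable_indic.
  rewrite RintegralT_D; last 2 first.
  - exact: bM.
  - by apply: bounded_measurableM; [exact: bounded_measurable_cst | exact: bM].
  rewrite RintegralT_Z; last exact: bM.
  by rewrite !Rintegral_past_slot // mulr0 addr0.
have pos := orthogonal_lln mX X1 orth.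
have neg : {ae P, forall w, negl (fun k => - X k w)}.
  apply: (@orthogonal_lln _ _ _ P (fun k w => - X k w)).
  - by move=> k; exact: measurable_funN.
  - by move=> k w; rewrite normrN.
  - by move=> i j ij; under eq_fun do rewrite mulrNN; exact: orth.
apply: filterS2 pos neg => w h1 h2; split => //.
by apply: negl_le h2 => k; rewrite /X -mulrN opprB.
Qed.

End PredictableLLN.

End PastSlot.

(** * Laws of large numbers for the EETB policy *)

(** Allows the state recursion to be examined separately for each value of its discrete
    arguments. *)
Lemma measurable_fun_glue d (T : measurableType d) d' (U : measurableType d')
    (X : countType) (z : T -> X) (f : X -> T -> U) :
  (forall x, measurable (z @^-1` [set x])) ->
  (forall x, measurable_fun setT (f x)) ->
  measurable_fun setT (fun w => f (z w) w).
Proof.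
move=> mz mf _ Y mY; rewrite setTI.
have -> : (fun w => f (z w) w) @^-1` Y = \bigcup_n
    (if unpickle n is Some x then z @^-1` [set x] `&` (f x @^-1` Y) else set0).
  apply/seteqP; split => [w Yw|w [n _]].
    by exists (pickle (z w)) => //; rewrite pickleK.
  by case: unpickle => [x [/= -> //]|].
apply: bigcupT_measurable => n; case: unpickle => [x|] //.
by apply: measurableI => //; rewrite -[X in measurable X]setTI; exact: mf.
Qed.

Section Model.
Context {R : realType} {d : measure_display} {T : measurableType d}.
Variable P : probability T R.
Variables (N : nat) (v pc pu Rad Ep : R) (Eu : R -> R).
Variables (Brem : nat -> T -> bool) (Urem : nat -> T -> 'I_N).
Variables (Req : nat -> T -> bool) (Rank : nat -> T -> 'I_N).
Variables (Dist : nat -> T -> R) (A : nat -> T -> R).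
Hypothesis hBrem_m : forall k (B : set bool), measurable (Brem k @^-1` B).
Hypothesis hUrem_m : forall k (B : set 'I_N), measurable (Urem k @^-1` B).
Hypothesis hReq_m : forall k (B : set bool), measurable (Req k @^-1` B).
Hypothesis hRank_m : forall k (B : set 'I_N), measurable (Rank k @^-1` B).
Hypothesis hDist_m : forall k, measurable_fun setT (Dist k).
Hypothesis hA_m : forall k, measurable_fun setT (A k).
Hypothesis hBrem : forall k, P [set w | Brem k w] = pc%:E.
Hypothesis hUrem : forall k (i : 'I_N), P [set w | Urem k w = i] = (N%:R^-1)%:E.
Hypothesis hReq : forall k, P [set w | Req k w] = pu%:E.
Hypothesis hRank : forall k (i : 'I_N),
  P [set w | Rank k w = i] = (popularity R N v i)%:E.
Hypothesis hDist : forall k x, 0 <= x <= Rad ->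
  P [set w | Dist k w <= x] = (x ^+ 2 / Rad ^+ 2)%:E.
Hypothesis hA_id : forall k (B : set R), measurable B ->
  P (A k @^-1` B) = P (A 0%N @^-1` B).
Hypothesis hindep :
  mutually_independent P (slot_events N Brem Urem Req Rank Dist A).
Variables (C C0 : nat) (E0 Eud : R).
Hypothesis hC : (C <= N)%N.
Hypothesis hC0 : (C0 <= N)%N.
Hypothesis Eu_m : measurable_fun setT Eu.

Let G := slot_events N Brem Urem Req Rank Dist A.

Lemma slot_events_T i : G i setT.
Proof. by case: i => k [] /=; exists setT => //; exact: measurableT. Qed.

Lemma slot_events_I i X Y : G i X -> G i Y -> G i (X `&` Y).
Proof.
by case: i => k [] [X' mX <-] [Y' mY <-]; exists (X' `&` Y') => //;
  exact: measurableI.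
Qed.

Lemma slot_events_measurable i X : G i X -> measurable X.
Proof.
case: i => k [] [Y mY <-]; rewrite /=; first exact: hBrem_m.
- exact: hUrem_m.
- exact: hReq_m.
- exact: hRank_m.
- by rewrite -[_ @^-1` _]setTI; exact: hDist_m.
- by rewrite -[_ @^-1` _]setTI; exact: hA_m.
Qed.

Let GT := slot_events_T.
Let GI := slot_events_I.
Let Gm := slot_events_measurable.
Let Tn n := g_sigma_algebraType (past G n).

Let gen n i X : (i.1 < n)%N -> G i X -> <<s past G n>> X.
Proof. exact: past_gen. Qed.

Lemma measurable_past_mono m n d' (U : measurableType d') (f : T -> U) :
  (m <= n)%N -> measurable_fun setT (f : Tn m -> U) ->
  measurable_fun setT (f : Tn n -> U).
Proof. by move=> mn mf _ Y mY; apply: (past_mono GT mn); exact: (mf _ Y mY). Qed.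

Let st k w := eetb_state R N C Ep Eud Eu C0 E0
  (Brem ^~ w) (Urem ^~ w) (Req ^~ w) (Rank ^~ w) (Dist ^~ w) (A ^~ w) k.

(** Measurability is with respect to the history [Tn k], which makes every event about the state
    admissible as a selection rule. *)
Lemma state_measurable k :
  measurable_fun setT ((fun w => (st k w).1) : Tn k -> nat) /\
  measurable_fun setT ((fun w => (st k w).2) : Tn k -> R).
Proof.
elim: k => [|k [IH1 IH2]].
  by split; exact: measurable_cst.
have mc : measurable_fun setT ((fun w => (st k w).1) : Tn k.+1 -> nat).
  exact: measurable_past_mono IH1.
have me : measurable_fun setT ((fun w => (st k w).2) : Tn k.+1 -> R).
  exact: measurable_past_mono IH2.
have mq : measurable_fun setT ((fun w => Eu (Dist k w)) : Tn k.+1 -> R).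
  have mD : measurable_fun setT (Dist k : Tn k.+1 -> R).
    move=> _ Y mY; rewrite setTI; apply: (@gen _ (k, VDist)) => //.
    by exists Y.
  exact: measurableT_comp Eu_m mD.
have ma : measurable_fun setT (A k : Tn k.+1 -> R).
  move=> _ Y mY; rewrite setTI; apply: (@gen _ (k, VHarv)) => //.
  by exists Y.
(* Once these discrete data are fixed, the action depends only on comparisons of the battery and the
   unicast energy. *)
pose z w := ((st k w).1, Brem k w, Urem k w, Req k w, Rank k w).
have mz x : @measurable _ (Tn k.+1) (z @^-1` [set x]).
  case: x => [[[[c b] u] r] i].
  have -> : z @^-1` [set (c, b, u, r, i)] =
      ((fun w => (st k w).1) @^-1` [set c]) `&` (Brem k @^-1` [set b]) `&`
      (Urem k @^-1` [set u]) `&` (Req k @^-1` [set r]) `&` (Rank k @^-1` [set i]).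
    apply/seteqP; split => w; rewrite /z /=.
      by move=> [h1 h2 h3 h4 h5].
    by move=> [[[[h1 h2] h3] h4] h5]; rewrite h1 h2 h3 h4 h5.
  have mI := @measurableI _ (Tn k.+1).
  apply: (mI); first apply: (mI); first apply: (mI); first apply: (mI).
  - by rewrite -[_ @^-1` _]setTI; exact: mc.
  - by apply: (@gen _ (k, VRem)) => //; exists [set b].
  - by apply: (@gen _ (k, VRemIdx)) => //; exists [set u].
  - by apply: (@gen _ (k, VReq)) => //; exists [set r].
  - by apply: (@gen _ (k, VRank)) => //; exists [set i].
pose act (x : nat * bool * 'I_N * bool * 'I_N) w :=
  let: (c, b, u, r, i) := x in
  eetb_action R N C Ep Eud c (st k w).2 r i (Eu (Dist k w)).
have mact (x : nat * bool * 'I_N * bool * 'I_N) d' (U : measurableType d')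
    (f g h : T -> U) :
  measurable_fun setT (f : Tn k.+1 -> U) -> measurable_fun setT (g : Tn k.+1 -> U) ->
  measurable_fun setT (h : Tn k.+1 -> U) ->
  measurable_fun setT ((fun w => match act x w with
    Sleep => f w | Unicast => g w | Push => h w end) : Tn k.+1 -> U).
  case: x => [[[[c b] u] r] i] mf mg mh; rewrite /act /eetb_action.
  case: (c < C)%N.
    have -> : (fun w => match (if Ep <= (st k w).2 then Push else Sleep) with
        Sleep => f w | Unicast => g w | Push => h w end) =
      (fun w => if Ep <= (st k w).2 then h w else f w).
      by apply/funext => w; case: ifP.
    apply: measurable_fun_ifT => //.
    by apply: measurable_fun_ler; [exact: measurable_cst | exact: me].
  pose bb w := [&& r, (c <= i)%N, 0 < Eu (Dist k w), Eu (Dist k w) <= Eud &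
    Eu (Dist k w) <= (st k w).2].
  rewrite (_ : (fun w => _) = (fun w => if bb w then g w else f w)); last first.
    by apply/funext => w; rewrite /bb; case: ifP.
  apply: measurable_fun_ifT => //.
  do 4 (apply: measurable_and; first by [exact: measurable_cst |
     apply: measurable_fun_ltr => //; exact: measurable_cst |
     apply: measurable_fun_ler => //; exact: measurable_cst]).
  exact: measurable_fun_ler.
split.
- pose f (x : nat * bool * 'I_N * bool * 'I_N) w :=
    let: (c, b, u, r, i) := x in next_C (act x w) c (Defs.drop b N u c).
  apply: (@measurable_fun_glue _ (Tn k.+1) _ _ _ z f) => //.
  case=> [[[[c b] u] r] i]; rewrite /f /next_C.
  apply: (mact (c, b, u, r, i) _ _ (fun=> _) (fun=> _) (fun=> _));
    exact: measurable_cst.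
- pose f (x : nat * bool * 'I_N * bool * 'I_N) w :=
    (st k w).2 - energy_used R Ep (Eu (Dist k w)) (act x w) + A k w.
  apply: (@measurable_fun_glue _ (Tn k.+1) _ _ _ z f) => // x.
  apply: measurable_funD => //; apply: measurable_funB => //.
  by apply: mact => //; exact: measurable_cst.
Qed.

Lemma state_event_past k (g : nat -> R -> bool) :
  (forall c, measurable_fun setT (g c)) ->
  <<s past G k>> [set w | g (st k w).1 (st k w).2].
Proof.
move=> mg; have [mc me] := state_measurable k.
have := @measurable_fun_glue _ (Tn k) _ _ _ (fun w => (st k w).1)
  (fun c w => g c (st k w).2).
have h1 x : @measurable _ (Tn k) ((fun w => (st k w).1) @^-1` [set x]).
  by rewrite -[_ @^-1` _]setTI; exact: mc.
move=> /(_ h1) h2.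
have h3 c : measurable_fun setT ((fun w => g c (st k w).2) : Tn k -> bool).
  by apply: (@measurableT_comp _ _ _ (Tn k) _ _ (g c)).
have := h2 h3 measurableT [set true] I.
by rewrite setTI.
Qed.

Lemma state_lln (g : nat -> R -> bool) (H : nat -> set T) (p : R) :
  (forall c, measurable_fun setT (g c)) ->
  (forall k, slot G k (H k)) -> (forall k, P (H k) = p%:E) ->
  {ae P, forall w,
    negl (fun k => (g (st k w).1 (st k w).2)%:R * (\1_(H k) w - p)) /\
    negl (fun k => (g (st k w).1 (st k w).2)%:R * (p - \1_(H k) w))}.
Proof.
move=> mg sH pH.
have := predictable_lln GT GI Gm hindep (fun k => @state_event_past k g mg) sH pH.
by apply: filterS => w [h1 h2]; split; [apply: negl_le h1|apply: negl_le h2] => k;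
  rewrite [\1_[set _ | _] w]indicE mem_setE.
Qed.

Lemma slot_prod k (B : slot_var -> set T) : (forall u, G (k, u) (B u)) ->
  slot G k [set w | forall u, B u w].
Proof. by move=> hB; exists B. Qed.

Let st_le k w : ((st k w).1 <= N)%N.
Proof. exact: stored_le. Qed.

Let dr k w := Defs.drop (Brem k w) N (Urem k w) (st k w).1.

(** A drop depends on the state, so it is split over the removed rank [i]: the condition [i < c]
    joins the selection rule, and removal of rank [i] has the fixed probability [pc / N]. *)
Lemma drop_lln (g : nat -> R -> bool) : (forall c, measurable_fun setT (g c)) ->
  {ae P, forall w,
    negl (fun k => (g (st k w).1 (st k w).2)%:R *
       ((dr k w)%:R - pc * (st k w).1%:R / N%:R)) /\
    negl (fun k => (g (st k w).1 (st k w).2)%:R *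
       (pc * (st k w).1%:R / N%:R - (dr k w)%:R))}.
Proof.
move=> mg.
pose B k (i : 'I_N) u := match u with VRem => [set w | Brem k w]
  | VRemIdx => [set w | Urem k w = i] | _ => setT end.
have hB k i u : G (k, u) (B k i u).
  case: u => /=; try exact: GT.
    by exists [set b : bool | b] => //; apply/seteqP; split.
  by exists [set i].
have pB k i : P [set w | forall u, B k i u w] = (pc / N%:R)%:E.
  rewrite (slot_prob hindep (hB k i)) /B hBrem hUrem !probability_setT !mule1.
  by rewrite -EFinM.
have mgi (i : 'I_N) c : measurable_fun setT (fun e => g c e && (i < c)%N).
  by apply: measurable_and => //; exact: measurable_cst.
have key (i : 'I_N) := @state_lln (fun c e => g c e && (i < c)%N) _ _ (mgi i)
  (fun k => slot_prod (hB k i)) (fun k => pB k i).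
have ind k w i : \1_[set w | forall u, B k i u w] w =
    (Brem k w && (Urem k w == i))%:R :> R.
  rewrite indicE; congr (_ %:R); congr nat_of_bool.
  apply/idP/idP => [|/andP[h1 /eqP h2]]; rewrite inE /=.
    by move=> h; have /= -> := h VRem; have /= -> := h VRemIdx; rewrite eqxx.
  by case.
have cnt c : (c <= N)%N -> \sum_(i < N) (i < c)%:R = c%:R :> R.
  move=> cN; rewrite -natr_sum -big_mkcond /= -(big_ord_widen N (fun=> 1%N) cN).
  by rewrite sum1_card card_ord.
have dsum k w : \sum_(i < N) ((i < (st k w).1)%N)%:R *
    (Brem k w && (Urem k w == i))%:R = (dr k w)%:R :> R.
  rewrite (bigD1 (Urem k w)) //= big1 => [|i /negbTE ni].
    by rewrite eqxx andbT addr0 /dr /Defs.drop -natrM mulnb andbC.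
  by rewrite eq_sym ni andbF mulr0.
apply: filterS (filter_forall _ key) => w hw; split.
- apply: (negl_le _ (@negl_sum R _ (index_enum 'I_N) _ (fun i => proj1 (hw i)))).
  move=> k /=; under eq_bigr => i _ do rewrite mulrBr ind.
  rewrite sumrB.
  have -> : \sum_(i < N) (g (st k w).1 (st k w).2 && (i < (st k w).1)%N)%:R * (pc / N%:R)
     = (g (st k w).1 (st k w).2)%:R * (pc * (st k w).1%:R / N%:R).
    rewrite -(cnt _ (st_le k w)) mulr_sumr mulr_suml mulr_sumr; apply: eq_bigr => i _.
    by rewrite -mulnb natrM; ring.
  rewrite mulrBr -dsum mulr_sumr lerD2r le_eqVlt; apply/orP; left; apply/eqP.
  by apply: eq_bigr => i _; rewrite -[in RHS]mulnb natrM; ring.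
- apply: (negl_le _ (@negl_sum R _ (index_enum 'I_N) _ (fun i => proj2 (hw i)))).
  move=> k /=; under eq_bigr => i _ do rewrite mulrBr ind.
  rewrite sumrB.
  have -> : \sum_(i < N) (g (st k w).1 (st k w).2 && (i < (st k w).1)%N)%:R * (pc / N%:R)
     = (g (st k w).1 (st k w).2)%:R * (pc * (st k w).1%:R / N%:R).
    rewrite -(cnt _ (st_le k w)) mulr_sumr mulr_suml mulr_sumr; apply: eq_bigr => i _.
    by rewrite -mulnb natrM; ring.
  rewrite mulrBr -dsum mulr_sumr lerD2l lerN2 le_eqVlt; apply/orP; left; apply/eqP.
  by apply: eq_bigr => i _; rewrite -[in LHS]mulnb natrM; ring.
Qed.


(** Splitting over the requested rank yields rectangles of a single slot, to which [state_lln]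
    applies. *)
Lemma request_lln (g : nat -> R -> bool) (x : R) : 0 <= x <= Rad ->
  (forall c, measurable_fun setT (g c)) ->
  let p := pu * (\sum_(i < N | (C <= i)%N) popularity R N v i) *
    (x ^+ 2 / Rad ^+ 2) in
  let y k w := [&& Req k w, (C <= Rank k w)%N & Dist k w <= x] in
  {ae P, forall w,
    negl (fun k => (g (st k w).1 (st k w).2)%:R * ((y k w)%:R - p)) /\
    negl (fun k => (g (st k w).1 (st k w).2)%:R * (p - (y k w)%:R))}.
Proof.
move=> hx mg p y.
pose B k (i : 'I_N) u := match u with VReq => [set w | Req k w]
  | VRank => [set w | Rank k w = i] | VDist => [set w | Dist k w <= x]
  | _ => setT end.
have hB k i u : G (k, u) (B k i u).
  case: u => /=; try exact: GT.
  - by exists [set b : bool | b] => //; apply/seteqP; split.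
  - by exists [set i].
  - exists `]-oo, x]%classic; first exact: measurable_itv.
    by apply/seteqP; split => w /=; rewrite in_itv.
have pB k i : P [set w | forall u, B k i u w] =
    (pu * popularity R N v i * (x ^+ 2 / Rad ^+ 2))%:E.
  rewrite (slot_prob hindep (hB k i)) /B hReq hRank hDist // !probability_setT.
  by rewrite !mule1 mul1e -!EFinM.
have ind k w i : \1_[set w | forall u, B k i u w] w =
    (Req k w && (Rank k w == i) && (Dist k w <= x))%:R :> R.
  rewrite indicE; congr (_ %:R); congr nat_of_bool.
  apply/idP/idP => [|/andP[/andP[h1 /eqP h2] h3]]; rewrite inE /=.
    move=> h; have /= -> := h VReq; have /= -> := h VRank.
    by have /= -> := h VDist; rewrite eqxx.
  by case.
have key (i : 'I_N) := @state_lln g _ _ mg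
  (fun k => slot_prod (hB k i)) (fun k => pB k i).
have ysum k w : (y k w)%:R = \sum_(i <- index_enum 'I_N | (C <= i)%N)
    \1_[set w | forall u, B k i u w] w :> R.
  rewrite /y; have [h|h] := leqP C (Rank k w).
    rewrite (bigD1 (Rank k w)) //= ind eqxx andbT big1 ?addr0 // => i /andP[_ ni].
    by rewrite ind eq_sym (negbTE ni) andbF.
  rewrite andbF big1 // => i iC; rewrite ind; case: eqP => [e|]; rewrite ?andbF //.
  by move: iC; rewrite -e leqNgt h.
have psum : p = \sum_(i <- index_enum 'I_N | (C <= i)%N)
    (pu * popularity R N v i * (x ^+ 2 / Rad ^+ 2)).
  by rewrite -mulr_suml -mulr_sumr.
apply: filterS (filter_forall _ key) => w hw; split.
- have h := @negl_sum R _ [seq i : 'I_N <- index_enum 'I_N | (C <= i)%N] _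
    (fun i => proj1 (hw i)).
  apply: negl_le h.
  by move=> k; rewrite big_filter -mulr_sumr sumrB -psum -ysum.
- have h := @negl_sum R _ [seq i : 'I_N <- index_enum 'I_N | (C <= i)%N] _
    (fun i => proj2 (hw i)).
  apply: negl_le h.
  by move=> k; rewrite big_filter -mulr_sumr sumrB -psum -ysum.
Qed.

(** * Lower bound on the harvested energy by step functions *)

Lemma count_le_floor (M : nat) (t : R) : 0 <= t ->
  let S := \sum_(j < M) (j.+1%:R <= t)%R%:R in
  S <= t /\ (M%:R <= S \/ t - 1 <= S).
Proof.
move=> t0 S; suff [h1 [h2 h3]] : S <= M%:R /\ (S <= t) /\ (M%:R <= S \/ t - 1 <= S) by [].
rewrite {}/S; elim: M => [|M [h1 [h2 h3]]]; first by rewrite big_ord0; split; [|split; [|left]].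
rewrite big_ord_recr /= -[M.+1]addn1 natrD; move: h1 h2 h3.
set S := \sum_(i < M) _ => h1 h2 h3; have [h|h] := leP (M%:R + 1%:R) t => /=.
  split; first lra; split; first lra.
  by case: h3 => ?; [left|right]; lra.
split; first lra; split; first lra.
by case: h3 => ?; right; lra.
Qed.

(** For [y >= 0] this is [y] rounded down to a multiple of [1 / m.+1] and capped at [m.+1], written
    as a finite sum of indicators so that the law for events applies. *)
Let step (m : nat) (y : R) : R :=
  m.+1%:R^-1 * \sum_(j < (m.+1 ^ 2)%N) (j.+1%:R <= y * m.+1%:R)%R%:R.

Lemma step_bounds m y : 0 <= y -> 0 <= step m y <= y.
Proof.
move=> y0; have m0 : 0 < m.+1%:R :> R by rewrite ltr0n.
have [h _] := @count_le_floor (m.+1 ^ 2) (y * m.+1%:R) (mulr_ge0 y0 (ltW m0)).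
apply/andP; split.
  by rewrite mulr_ge0 ?invr_ge0 ?(ltW m0) // sumr_ge0 // => j _; case: (_ <= _).
by rewrite /step ler_pdivrMl // [X in _ <= X]mulrC.
Qed.

Lemma step_cvg y : 0 <= y -> (fun m => step m y) @ \oo --> y.
Proof.
move=> y0; apply/cvgrPdist_le => e e0; near=> m.
have m0 : 0 < m.+1%:R :> R by rewrite ltr0n.
have [/andP[_ h1] t0] : 0 <= step m y <= y /\ 0 <= y * m.+1%:R.
  by split; [exact: step_bounds | rewrite mulr_ge0 // ltW].
rewrite ger0_norm ?subr_ge0 //.
have [_ h2] := @count_le_floor (m.+1 ^ 2) _ t0.
have hy : y <= m.+1%:R.
  by apply: (@le_trans _ _ m%:R); [near: m; exact: nbhs_infty_ger | rewrite ler_nat].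
have he : e^-1 <= m.+1%:R.
  by apply: (@le_trans _ _ m%:R); [near: m; exact: nbhs_infty_ger | rewrite ler_nat].
have {}h2 : y * m.+1%:R - 1 <= \sum_(j < (m.+1 ^ 2)%N) (j.+1%:R <= y * m.+1%:R)%R%:R.
  case: h2 => // h2; apply: le_trans h2; rewrite natrX; nra.
have : y - m.+1%:R^-1 <= step m y.
  rewrite /step ler_pdivlMl // mulrBr mulfV ?gt_eqF //; lra.
have ie : m.+1%:R^-1 <= e by rewrite invf_ple ?posrE.
rewrite lerBlDr => h3; rewrite lerBlDl; apply: le_trans h3 _.
by rewrite lerD2l.
Unshelve. all: by end_near. Qed.

Variable Abar : R.
Hypothesis hA_nneg : forall k w, 0 <= A k w.
Hypothesis hA_int : P.-integrable setT (EFin \o A 0).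
Hypothesis hA_mean : ('E_P[A 0%N])%E = Abar%:E.

Let level m (j : nat) : set R := [set y | j.+1%:R <= y * m.+1%:R].

Let level_measurable m j : measurable (level m j).
Proof.
rewrite /level (_ : mkset _ = `[j.+1%:R / m.+1%:R, +oo[%classic).
  exact: measurable_itv.
apply/seteqP; split => y /=; rewrite in_itv /= andbT ler_pdivrMr ?ltr0n //.
Qed.

Let step_indic m w k : step m (A k w) =
  m.+1%:R^-1 * \sum_(j < (m.+1 ^ 2)%N) \1_(A k @^-1` level m j) w.
Proof.
congr (_ * _); apply: eq_bigr => j _.
rewrite indicE; congr (_%:R); congr nat_of_bool.
by apply/idP/idP; rewrite inE.
Qed.

Let level_prob m k j :
  P (A k @^-1` level m j) = (fine (P (A 0 @^-1` level m j)))%:E.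
Proof.
rewrite hA_id // fineK //; apply: fin_num_measure.
by rewrite -[_ @^-1` _]setTI; exact: hA_m.
Qed.

Let step_mean m : R :=
  m.+1%:R^-1 * \sum_(j < (m.+1 ^ 2)%N) fine (P (A 0 @^-1` level m j)).

Lemma step_mean_cvg : step_mean @ \oo --> Abar.
Proof.
have mL m j : measurable (A 0 @^-1` level m j).
  by rewrite -[_ @^-1` _]setTI; exact: hA_m.
have ms m : measurable_fun setT (fun w => (step m (A 0 w))%:E).
  apply/measurable_EFinP; under eq_fun do rewrite step_indic.
  apply: measurable_funM; first exact: measurable_cst.
  by apply: measurable_sum => j; exact: measurable_indic.
have -> : step_mean = fine \o (fun m => \int[P]_w (step m (A 0 w))%:E)%E.
  apply/funext => m /=; under eq_integral do rewrite step_indic.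
  have sumI n : \int[P]_w (\sum_(j < n) \1_(A 0 @^-1` level m j) w) =
      \sum_(j < n) fine (P (A 0 @^-1` level m j)).
    elim: n => [|n IH].
      under eq_Rintegral do rewrite big_ord0.
      by rewrite Rintegral_cst // mul0r big_ord0.
    under eq_Rintegral do rewrite big_ord_recr /=.
    rewrite RintegralT_D; last 2 first.
    - apply: (@bounded_measurable_sum _ _ _ n (fun j => \1_(A 0 @^-1` level m j))).
      by move=> j; exact: bounded_measurable_indic.
    - exact: bounded_measurable_indic.
    by rewrite IH Rintegral_indic // big_ord_recr.
  rewrite /step_mean -sumI -RintegralT_Z //.
  apply: (@bounded_measurable_sum _ _ _ (m.+1 ^ 2) (fun j => \1_(A 0 @^-1` level m j))).
  by move=> j; exact: bounded_measurable_indic.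
apply: fine_cvg; rewrite -hA_mean unlock.
apply: (@dominated_cvg _ _ _ P setT measurableT _ _ (EFin \o A 0)) => //.
- by move=> w _; apply/fine_cvgP; split; [exact: nearW | exact: step_cvg].
- move=> m w _; rewrite /= lee_fin.
  by have /andP[h1 h2] := step_bounds m (hA_nneg 0 w); rewrite ger0_norm.
Qed.

(** As [step m] stays below the identity, the laws for finitely many level events bound the harvest
    from below with mean [step_mean m], which tends to [Abar] by dominated convergence. *)
Lemma harvest_lln : {ae P, forall w, negl (fun k => Abar - A k w)}.
Proof.
have sl m j k : slot G k (A k @^-1` level m j).
  pose B u := match u with VHarv => A k @^-1` level m j | _ => setT end.
  rewrite (_ : _ @^-1` _ = [set w | forall u, B u w]).
    apply: slot_prod; case; try exact: GT.
    by exists (level m j) => //; exact: level_measurable.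
  apply/seteqP; split => w /=; first by move=> ?; case.
  by move/(_ VHarv).
have pT k : <<s past G k>> setT by apply: sub_sigma_algebra; exact: past_T.
have key m j := predictable_lln GT GI Gm hindep (F := fun=> setT) pT (sl m j)
  (fun k => level_prob m k j).
have := @ae_foralln _ _ _ P _ (fun m => @ae_foralln _ _ _ P _ (key m)).
apply: filterS => w hw; apply: negl_eps => e e0.
have /cvgrPdist_le /(_ _ e0) [m _ /(_ _ (leqnn m)) hm] := step_mean_cvg.
have i0 : 0 <= (m.+1%:R : R)^-1 by rewrite invr_ge0 ler0n.
have := neglZ i0 (@negl_sum R _ (index_iota 0 (m.+1 ^ 2)) _ (fun j => proj2 (hw m j))).
apply: negl_le => k; under eq_bigr do rewrite indicT mul1r.
rewrite sumrB mulrBr !big_mkord -/(step_mean m) -step_indic.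
have /andP[_ h] := step_bounds m (hA_nneg k w).
by have := ler_norm (Abar - step_mean m); lra.
Qed.

End Model.

(** * Unicast energy and popularity *)

Section UnicastEnergy.
Context {R : realType}.
Variables (Eu : R -> R) (Rad : R).
Hypothesis Rad0 : 0 < Rad.
Hypothesis Eu_cont : {within `[0, Rad], continuous Eu}.
Hypothesis Eu_incr : {in `[0, Rad] &, forall x y, x < y -> Eu x < Eu y}.
Hypothesis Eu_nneg : {in `[0, Rad], forall x, 0 <= Eu x}.

Let F := partial_unicast_energy R Eu Rad.

Lemma Eu_le x y : 0 <= x -> x <= y -> y <= Rad -> Eu x <= Eu y.
Proof.
move=> x0 xy yR; have [->//|nxy] := eqVneq x y; apply/ltW/Eu_incr.
- by rewrite in_itv /= x0 (le_trans xy).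
- by rewrite in_itv /= yR (le_trans x0).
- by rewrite lt_neqAle nxy.
Qed.

Lemma Eu_gt0 x : 0 < x -> x <= Rad -> 0 < Eu x.
Proof.
move=> x0 xR; apply: (@le_lt_trans _ _ (Eu 0)).
  by apply: Eu_nneg; rewrite in_itv /= lexx ltW.
by apply: Eu_incr => //; rewrite in_itv /= ?lexx ltW // (lt_le_trans x0).
Qed.

Lemma integral_linear_density c x y : x < y ->
  \int[lebesgue_measure]_(t in `[x, y]) (c * (2 * t / Rad ^+ 2)) =
    c * ((y ^+ 2 - x ^+ 2) / Rad ^+ 2).
Proof.
move=> xy.
pose H : R -> R := (c / Rad ^+ 2) \*: ((id : R -> R) ^+ 2).
have HE t : H t = c / Rad ^+ 2 * t ^+ 2 by rewrite /H /= exprfctE.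
have dH (t : R) : is_derive t (1 : R) H (c * (2 * t / Rad ^+ 2)).
  have h := is_deriveZ (c / Rad ^+ 2) (is_deriveX 1 (is_derive_id t (1 : R))).
  apply: is_derive_eq; rewrite expr1 /GRing.scale /=; field.
  by rewrite gt_eqF.
have cH : continuous H.
  by move=> t; apply: differentiable_continuous; apply/derivable1_diffP; case: (dH t).
rewrite /Rintegral (@continuous_FTC2 _ _ H) //.
- by rewrite /= !HE; field; rewrite gt_eqF.
- apply: continuous_subspaceT => t; apply: cvgM; first exact: cvg_cst.
  apply: cvgM; last exact: cvg_cst.
  by apply: cvgM; [exact: cvg_cst | exact: cvg_id].
- split.
  + by move=> t _; case: (dH t).
  + exact/cvg_at_right_filter/cH.
  + exact/cvg_at_left_filter/cH.
- by move=> t _; rewrite derive1E; case: (dH t).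
Qed.

Lemma density_integrable y : 0 <= y -> y <= Rad ->
  lebesgue_measure.-integrable `[0, y]
    (EFin \o (fun t => Eu t * (2 * t / Rad ^+ 2))).
Proof.
move=> y0 yR; apply: continuous_compact_integrable; first exact: segment_compact.
apply: (@continuous_subspaceW _ _ _ `[0, Rad]).
  by move=> t /=; rewrite !in_itv /= => /andP[-> /le_trans]; exact.
move=> t; apply: cvgM; first exact: Eu_cont.
have : {within `[0, Rad], continuous (fun t : R => 2 * t / Rad ^+ 2)}.
  apply: continuous_subspaceT => s; apply: cvgM; last exact: cvg_cst.
  by apply: cvgM; [exact: cvg_cst | exact: cvg_id].
exact.
Qed.

Lemma partial_energy_diff x y : 0 <= x -> x <= y -> y <= Rad ->
  Eu x * ((y ^+ 2 - x ^+ 2) / Rad ^+ 2) <= F y - F x.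
Proof.
move=> x0; rewrite le_eqVlt => /orP[/eqP <-|xy] yR.
  by rewrite !subrr mul0r mulr0.
have y0 : 0 <= y by rewrite (le_trans x0) ?ltW.
have iy := density_integrable y0 yR.
rewrite /F /partial_unicast_energy Rintegral_itvB //.
- have ixy : lebesgue_measure.-integrable `[x, y]
      (EFin \o (fun t : R => Eu x * (2 * t / Rad ^+ 2))).
    apply: continuous_compact_integrable; first exact: segment_compact.
    apply: continuous_subspaceT => t; apply: cvgM; first exact: cvg_cst.
    apply: cvgM; last exact: cvg_cst.
    by apply: cvgM; [exact: cvg_cst | exact: cvg_id].
  rewrite -(integral_linear_density (Eu x) xy) -Rintegral_itv_obnd_cbnd.
    apply: le_Rintegral => //.
    + apply: integrableS ixy => //.
      by apply: subset_itvScc; rewrite bnd_simp.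
    + apply: integrableS iy => //.
      by apply: subset_itvScc; rewrite bnd_simp.
    + move=> t /=; rewrite in_itv /= => /andP[xt ty].
      apply: ler_wpM2r; last by apply: Eu_le => //; [exact: ltW | exact: le_trans ty yR].
      by rewrite divr_ge0 ?exprn_ge0 ?(ltW Rad0) // mulr_ge0 // (le_trans x0) ?ltW.
  apply: integrableS ixy => //.
  by apply: subset_itvScc; rewrite bnd_simp.
- by rewrite bnd_simp ltW.
Qed.

Lemma partial_energy0 : F 0 = 0.
Proof. by rewrite /F /partial_unicast_energy set_itv1 Rintegral_set1. Qed.

Lemma partial_energy_ge0 x : 0 <= x -> x <= Rad -> 0 <= F x.
Proof.
move=> x0 xR; have := partial_energy_diff (lexx 0) x0 xR.
rewrite partial_energy0 subr0; apply: le_trans.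
rewrite expr0n subr0 mulr_ge0 //.
  by apply: Eu_nneg; rewrite in_itv /= lexx ltW.
by rewrite divr_ge0 // exprn_ge0 // ltW.
Qed.

Variable dt : R.
Hypothesis dt0 : 0 <= dt.
Hypothesis dtR : dt <= Rad.

(** The minimum keeps the grid at [dt] past its end, so its bounds hold for every index. *)
Definition grid (n i : nat) : R := dt * (minn i n.+1)%:R / n.+1%:R.

Let n1 n : 0 < n.+1%:R :> R. Proof. by rewrite ltr0n. Qed.

Lemma grid0 n : grid n 0 = 0. Proof. by rewrite /grid min0n mulr0 mul0r. Qed.

Lemma grid_last n : grid n n.+1 = dt.
Proof. by rewrite /grid minnn mulfK // gt_eqF. Qed.

Lemma grid_bounds n i : 0 <= grid n i <= dt.
Proof.
apply/andP; split; first by rewrite divr_ge0 ?mulr_ge0 // ltW.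
by rewrite ler_pdivrMr // ler_wpM2l // ler_nat geq_minr.
Qed.

Lemma grid_step n i : grid n i <= grid n i.+1 <= grid n i + dt / n.+1%:R.
Proof.
apply/andP; split.
  by rewrite ler_wpM2r ?invr_ge0 ?(ltW (n1 n)) // ler_wpM2l // ler_nat; lia.
rewrite /grid -mulrDl ler_wpM2r ?invr_ge0 ?(ltW (n1 n)) //.
by rewrite -[X in _ + X]mulr1 -mulrDr ler_wpM2l // natr1 ler_nat; lia.
Qed.

(** The lower sum is at most [F dt] by [partial_energy_diff]. Each ring has mass at most
    [2 * dt ^ 2 / Rad ^ 2 / n.+1], and the increments of [Eu] telescope, so the two sums differ by
    at most [K / n.+1]. *)
Lemma upper_riemann_sum eps : 0 < eps -> exists n,
  \sum_(i < n.+1) Eu (grid n i.+1) * ((grid n i.+1 ^+ 2 - grid n i ^+ 2) / Rad ^+ 2)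
    <= F dt + eps.
Proof.
move=> e0; have R2 : 0 < Rad ^+ 2 by exact: exprn_gt0.
pose K := 2 * dt ^+ 2 / Rad ^+ 2 * (Eu dt - Eu 0).
have Edt : 0 <= Eu dt - Eu 0 by rewrite subr_ge0 Eu_le.
have [n hn] : exists n : nat, K / eps <= n%:R.
  by exists (Num.truncn (K / eps)).+1; exact: ltW (truncnS_gt _).
exists n; have gb := grid_bounds n; have gs := grid_step n.
have low m : \sum_(i < m) Eu (grid n i) *
    ((grid n i.+1 ^+ 2 - grid n i ^+ 2) / Rad ^+ 2) <= F (grid n m).
  elim: m => [|m IH]; first by rewrite big_ord0 grid0 partial_energy0.
  rewrite big_ord_recr /=.
  have [/andP[g1 g2] /andP[g3 g4] /andP[g5 g6]] := And3 (gb m) (gb m.+1) (gs m).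
  by have := partial_energy_diff g1 g5 (le_trans g4 dtR); lra.
have diff m : \sum_(i < m) (Eu (grid n i.+1) - Eu (grid n i)) *
    ((grid n i.+1 ^+ 2 - grid n i ^+ 2) / Rad ^+ 2) <=
    2 * dt ^+ 2 / Rad ^+ 2 / n.+1%:R * (Eu (grid n m) - Eu 0).
  elim: m => [|m IH]; first by rewrite big_ord0 grid0 subrr mulr0.
  rewrite big_ord_recr /=.
  have [/andP[g1 g2] /andP[g3 g4] /andP[g5 g6]] := And3 (gb m) (gb m.+1) (gs m).
  have h1 : (grid n m.+1 ^+ 2 - grid n m ^+ 2) / Rad ^+ 2 <=
      2 * dt ^+ 2 / Rad ^+ 2 / n.+1%:R.
    rewrite [leRHS]mulrAC ler_wpM2r ?invr_ge0 ?(ltW R2) //.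
    rewrite subr_sqr; apply: (@le_trans _ _ (dt / n.+1%:R * (2 * dt))).
      by move: g6; set s := dt / _ => g6; apply: ler_pM; lra.
    by rewrite le_eqVlt; apply/orP; left; apply/eqP; ring.
  have h2 : 0 <= Eu (grid n m.+1) - Eu (grid n m).
    by rewrite subr_ge0 Eu_le // (le_trans g4).
  move: IH h1; set s := _ / n.+1%:R => IH h1.
  by have := ler_wpM2l h2 h1; lra.
have Kn : K / n.+1%:R <= eps.
  rewrite ler_pdivrMr // mulrC -ler_pdivrMr //.
  by apply: le_trans hn _; rewrite ler_nat.
have -> : \sum_(i < n.+1) Eu (grid n i.+1) *
    ((grid n i.+1 ^+ 2 - grid n i ^+ 2) / Rad ^+ 2) =
  \sum_(i < n.+1) Eu (grid n i) * ((grid n i.+1 ^+ 2 - grid n i ^+ 2) / Rad ^+ 2) +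
  \sum_(i < n.+1) (Eu (grid n i.+1) - Eu (grid n i)) *
    ((grid n i.+1 ^+ 2 - grid n i ^+ 2) / Rad ^+ 2).
  by rewrite -big_split /=; apply: eq_bigr => i _; ring.
have := low n.+1; have := diff n.+1; rewrite grid_last.
have -> : 2 * dt ^+ 2 / Rad ^+ 2 / n.+1%:R * (Eu dt - Eu 0) = K / n.+1%:R.
  by rewrite /K; ring.
move: Kn; set q := K / _; lra.
Qed.

(** Only the ring containing [x] contributes, with the energy at its outer radius. *)
Lemma energy_le_grid n x (b : bool) : 0 < x -> x <= Rad ->
  (b && (x <= dt))%:R * Eu x <= \sum_(i < n.+1) Eu (grid n i.+1) *
    ((b && (x <= grid n i.+1))%:R - (b && (x <= grid n i))%:R).
Proof.
move=> x0 xR; 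
suff h m : (b && (x <= grid n m))%:R * Eu x <= \sum_(i < m) Eu (grid n i.+1) *
    ((b && (x <= grid n i.+1))%:R - (b && (x <= grid n i))%:R).
  by have := h n.+1; rewrite grid_last.
elim: m => [|m IH].
  by rewrite big_ord0 grid0 (leNgt x 0) x0 andbF mul0r.
rewrite big_ord_recr /=; apply: le_trans (lerD IH (lexx _)).
have [/andP[g1 g2] /andP[g3 g4] /andP[g5 g6]] :=
  And3 (grid_bounds n m) (grid_bounds n m.+1) (grid_step n m).
case: b {IH} => /=; last by rewrite !mul0r subrr mulr0 addr0.
have [h|h] := leP x (grid n m); first by rewrite (le_trans h g5); lra.
case: (leP x (grid n m.+1)) => h' /=; last by lra.
rewrite mul0r add0r mul1r subr0 mulr1; apply: Eu_le => //; first exact: ltW.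
exact: le_trans g4 dtR.
Qed.

(** * Energy of near requests along a sample path *)

Section Requests.
Variables (high asked : nat -> bool) (x : nat -> R) (p : R).
Hypothesis p0 : 0 <= p.
Hypothesis x_gt0 : forall k, 0 < x k.
Hypothesis x_le : forall k, x k <= Rad.
Hypothesis lln : forall n i, negl (fun k => (high k)%:R *
  ((asked k && (x k <= grid n i))%:R - p * (grid n i ^+ 2 / Rad ^+ 2))).
Hypothesis lln' : forall n i, negl (fun k => (high k)%:R *
  (p * (grid n i ^+ 2 / Rad ^+ 2) - (asked k && (x k <= grid n i))%:R)).

Lemma negl_unicast_energy : negl (fun k => (high k)%:R *
  ((asked k && (x k <= dt))%:R * Eu (x k) - p * F dt)).
Proof.
apply: negl_eps => e e0; have p1 : 0 < p + 1 by have := p0; lra.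
(* The Riemann error gets multiplied by [p]; the divisor [p + 1] keeps the product below [e] even
   for [p = 0]. *)
have [n hn] := upper_riemann_sum (divr_gt0 e0 p1).
have W (i : 'I_n.+1) : 0 <= Eu (grid n i.+1).
  by have /andP[g1 g2] := grid_bounds n i.+1; apply: Eu_nneg;
    rewrite in_itv /= g1 (le_trans g2).
have := @negl_sum R _ (index_enum 'I_n.+1) _
  (fun i => neglZ (W i) (neglD (lln n i.+1) (lln' n i))).
apply: negl_le => k.
have -> : \sum_(i < n.+1) Eu (grid n i.+1) * ((high k)%:R *
      ((asked k && (x k <= grid n i.+1))%:R - p * (grid n i.+1 ^+ 2 / Rad ^+ 2)) +
    (high k)%:R *
      (p * (grid n i ^+ 2 / Rad ^+ 2) - (asked k && (x k <= grid n i))%:R)) =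
  (high k)%:R * (\sum_(i < n.+1) Eu (grid n i.+1) *
      ((asked k && (x k <= grid n i.+1))%:R - (asked k && (x k <= grid n i))%:R) -
    p * \sum_(i < n.+1) Eu (grid n i.+1) *
      ((grid n i.+1 ^+ 2 - grid n i ^+ 2) / Rad ^+ 2)).
  by rewrite mulr_sumr -sumrB mulr_sumr; apply: eq_bigr => i _; ring.
case: (high k); last by rewrite !mul0r; lra.
rewrite !mul1r; have h1 := energy_le_grid n (asked k) (x_gt0 k) (x_le k).
have h2 := ler_wpM2l p0 hn.
have : p * (F dt + e / (p + 1)) <= p * F dt + e.
  rewrite mulrDr lerD2l mulrCA ger_pMr // ler_pdivrMr //; lra.
lra.
Qed.

(** A request cheaper than [Eu (grid n 1)] comes from the innermost disk, whose frequency is of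
    order [1 / n.+1 ^ 2]. For [dt = 0] there is no near request, since distances are positive. *)
Lemma negl_cheap_requests (eps : R) : 0 < eps -> exists2 del : R, 0 < del &
  negl (fun k => (high k)%:R *
    ((asked k && (x k <= dt)) && (Eu (x k) < del))%:R - eps).
Proof.
move=> e0; have [dt_0|dtn0] := eqVneq dt 0.
  exists 1 => //; apply: (@negl_bounded _ _ 0) => K; apply: sumr_le0 => k _.
  by rewrite dt_0 (leNgt (x k) 0) x_gt0 andbF mulr0; lra.
have dtp : 0 < dt by rewrite lt_neqAle eq_sym dtn0.
pose K := p * (dt ^+ 2 / Rad ^+ 2).
have [n hn] : exists n : nat, K / eps <= n%:R.
  by exists (Num.truncn (K / eps)).+1; exact: ltW (truncnS_gt _).
have gE : grid n 1 = dt / n.+1%:R by rewrite /grid minnSS min0n mulr1.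
have g0 : 0 < grid n 1 by rewrite gE divr_gt0.
have /andP[_ gd] := grid_bounds n 1.
exists (Eu (grid n 1)); first by apply: Eu_gt0 => //; exact: le_trans gd dtR.
apply: negl_le (lln n 1) => k.
have Kn : p * (grid n 1 ^+ 2 / Rad ^+ 2) <= eps.
  have -> : p * (grid n 1 ^+ 2 / Rad ^+ 2) = K / n.+1%:R ^+ 2.
    by rewrite gE expr_div_n /K; ring.
  rewrite ler_pdivrMr ?exprn_gt0 // mulrC -ler_pdivrMr //.
  apply: le_trans hn _; rewrite -natrX ler_nat; nia.
case: (high k); last by rewrite !mul0r; lra.
rewrite !mul1r; case: (asked k) => /=; last by lra.
have [h|h] := leP (x k) (grid n 1).
  by rewrite (le_trans h gd); case: (_ < _) => /=; lra.
have := Eu_le (ltW g0) (ltW h) (x_le k).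
by rewrite ltNge => ->; rewrite andbF /=; lra.
Qed.

End Requests.

End UnicastEnergy.

(** * Popularity tail and the energy threshold *)

Section Popularity.
Context {R : realType}.
Variables (N : nat) (v pc pu Ep Ebar : R).
Hypothesis hN : (0 < N)%N.
Hypothesis hv : 0 < v.
Hypothesis pc0 : 0 < pc.
Hypothesis pc1 : pc <= 1.
Hypothesis pu0 : 0 <= pu.
Hypothesis Ep0 : 0 < Ep.
Hypothesis Ebar0 : 0 <= Ebar.

Lemma zipf_sum_gt0 : 0 < zipf_sum R N v.
Proof.
rewrite /zipf_sum; case: N hN => // n _; rewrite big_ord_recl ltr_wpDr //.
  by apply: sumr_ge0 => i _; exact: powR_ge0.
Qed.

Lemma popularity_ge0 i : 0 <= popularity R N v i.
Proof. by rewrite /popularity divr_ge0 ?powR_ge0 // ltW // zipf_sum_gt0. Qed.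

Lemma popularity_tail C :
  \sum_(i < N | (C <= i)%N) popularity R N v i = 1 - pop_head R N v C.
Proof.
have : \sum_(i < N) popularity R N v i = 1.
  by rewrite /popularity -mulr_suml mulfV // gt_eqF // zipf_sum_gt0.
rewrite (bigID (fun i : 'I_N => (i < C)%N)) /= => <-.
by rewrite /pop_head addrAC subrr add0r; apply: eq_bigl => i; rewrite -leqNgt.
Qed.

(* Below [N], the threshold bounds the popularity of the content of rank [C + 1],
   and the tail beyond rank [C] weighs at most [N] times that popularity. *)
Lemma threshold_energy_le C : C = C_thr_EE R N v pc pu Ep Ebar ->
  pu * (1 - pop_head R N v C) * Ebar <= Ep.
Proof.
move=> Cdef; rewrite -popularity_tail; have Z0 := zipf_sum_gt0.
have N0 : 0 < N%:R :> R by rewrite ltr0n.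
have [NC|CN] := leqP N C.
  rewrite big1 ?mulr0 ?mul0r ?ltW // => i iC.
  by have := leq_trans NC iC; rewrite leqNgt ltn_ord.
set Y := N%:R * pu * Ebar / (pc * Ep * zipf_sum R N v).
have Y0 : 0 <= Y by rewrite divr_ge0 ?mulr_ge0 // ltW.
have CE : C = Num.truncn (Y `^ (1 / v)).
  have [h|h] := leqP N (Num.truncn (Y `^ (1 / v))).
    by move: CN; rewrite Cdef /C_thr_EE -/Y (minn_idPl h) ltnn.
  by rewrite Cdef /C_thr_EE -/Y; exact/minn_idPr/ltnW.
(* [C] is the integer part of the [v]-th root of [Y], so [C + 1] exceeds that root. *)
have YC : Y <= C.+1%:R `^ v.
  have -> : Y = (Y `^ (1 / v)) `^ v.
    by rewrite -powRrM mulrAC mulfK ?gt_eqF // powRr1.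
  apply: ge0_ler_powR; rewrite ?nnegrE ?powR_ge0 ?ler0n ?(ltW hv) //.
  by rewrite CE; exact: ltW (truncnS_gt _).
have YE : N%:R * pu * Ebar = Y * (pc * Ep * zipf_sum R N v).
  by rewrite /Y mulfVK // gt_eqF // !mulr_gt0.
set c := C.+1%:R `^ v in YC.
have c0 : 0 < c by apply: powR_gt0; rewrite ltr0n.
have tail : \sum_(i < N | (C <= i)%N) popularity R N v i <=
    N%:R * (c^-1 / zipf_sum R N v).
  apply: (@le_trans _ _ (\sum_(i < N) (c^-1 / zipf_sum R N v))); last first.
    by rewrite sumr_const card_ord mulr_natl.
  rewrite big_mkcond; apply: ler_sum => i _; case: ifP => [Ci|_].
    rewrite /popularity ler_wpM2r ?invr_ge0 ?(ltW Z0) //.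
    rewrite powRN lef_pV2 ?posrE ?powR_gt0 ?ltr0n //.
    by apply: ge0_ler_powR; rewrite ?nnegrE ?ler0n ?(ltW hv) // ler_nat.
  by rewrite divr_ge0 ?invr_ge0 // ltW.
apply: (@le_trans _ _ (pu * (N%:R * (c^-1 / zipf_sum R N v)) * Ebar)).
  by apply: ler_wpM2r => //; exact: ler_wpM2l.
have -> : pu * (N%:R * (c^-1 / zipf_sum R N v)) * Ebar =
    N%:R * pu * Ebar * (c^-1 / zipf_sum R N v) by ring.
rewrite YE.
have -> : Y * (pc * Ep * zipf_sum R N v) * (c^-1 / zipf_sum R N v) = pc * Ep * (Y / c).
  by field; rewrite !gt_eqF.
have : Y / c <= 1 by rewrite ler_pdivrMr // mul1r.
have : 0 <= pc * Ep by rewrite mulr_ge0 // ltW.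
have : pc * Ep <= Ep by rewrite ger_pMl.
nra.
Qed.

End Popularity.

(** * Blocking probability *)

Lemma eq_eetb_state (R : realType) N C (Ep Eud : R) Eu Eu' C0 E0 brem urem req rank
    dist harv : (forall k : nat, Eu (dist k) = Eu' (dist k)) -> forall k,
  eetb_state R N C Ep Eud Eu C0 E0 brem urem req rank dist harv k =
  eetb_state R N C Ep Eud Eu' C0 E0 brem urem req rank dist harv k.
Proof. by move=> eq_Eu; elim=> [//|k IH] /=; rewrite IH !eq_Eu. Qed.

Lemma eq_eetb_blocked (R : realType) N C (Ep Eud : R) Eu Eu' C0 E0 brem urem req rank
    dist harv : (forall k : nat, Eu (dist k) = Eu' (dist k)) -> forall k,
  eetb_blocked R N C Ep Eud Eu C0 E0 brem urem req rank dist harv k =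
  eetb_blocked R N C Ep Eud Eu' C0 E0 brem urem req rank dist harv k.
Proof.
move=> eq_Eu k; rewrite /eetb_blocked.
by rewrite !(@eq_eetb_state R N C Ep Eud Eu Eu' C0 E0 brem urem req rank dist harv eq_Eu) eq_Eu.
Qed.

(** The distribution function is zero at [0] and one at [Rad]. Excluding distance zero makes every
    unicast energy positive, so the policy's test [0 < q] always succeeds. *)
Lemma ae_distance_bounds (R : realType) d (T : measurableType d)
    (P : probability T R) (Dist : nat -> T -> R) (Rad : R) : 0 < Rad ->
  (forall k, measurable_fun setT (Dist k)) ->
  (forall k x, 0 <= x <= Rad ->
     P [set w | Dist k w <= x] = (x ^+ 2 / Rad ^+ 2)%:E) ->
  {ae P, forall w, forall k, 0 < Dist k w <= Rad}.
Proof.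
move=> Rad0 Dist_m hDist; apply/ae_foralln => k.
have mD x : measurable [set w | Dist k w <= x].
  rewrite (_ : mkset _ = setT `&` Dist k @^-1` `]-oo, x]%classic).
    exact: Dist_m (measurable_itv _).
  by rewrite setTI; apply/seteqP; split => w /=; rewrite in_itv.
have n0 : P.-negligible [set w | Dist k w <= 0].
  exists [set w | Dist k w <= 0]; split => //.
  by rewrite hDist ?lexx ?ltW // expr0n mul0r.
have nR : P.-negligible (~` [set w | Dist k w <= Rad]).
  exists (~` [set w | Dist k w <= Rad]); split => //; first exact: measurableC.
  rewrite probability_setC // hDist ?lexx ?ltW // divff ?subee //.
  by rewrite expf_neq0 // gt_eqF.
apply: negligibleS (negligibleU n0 nR) => w /=.
case: (leP (Dist k w) 0) => h; first by left.
by case: (leP (Dist k w) Rad) => h' //= _; right.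
Qed.

Unset Implicit Arguments.

Theorem theorem2
  (R : realType) (d : measure_display) (T : measurableType d)
  (P : probability T R)
  (* system parameters *)
  (N : nat) (v pc pu Rad Ep Abar : R) (Eu : R -> R)
  (hN : (0 < N)%N) (hv : 0 < v) (hpc : 0 < pc <= 1) (hpu : 0 <= pu <= 1)
  (hRad : 0 < Rad) (hEp : 0 < Ep)
  (hEu_cont : {within `[0, Rad], continuous Eu})
  (hEu_incr : {in `[0, Rad] &, forall x y, x < y -> Eu x < Eu y})
  (hEu_nneg : {in `[0, Rad], forall x, 0 <= Eu x})
  (* random inputs of slot k *)
  (Brem : nat -> T -> bool)   (* a content is removed in slot k *)
  (Urem : nat -> T -> 'I_N)   (* 0-based rank of the removed content *)
  (Req : nat -> T -> bool)    (* a request arrives in slot k *)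
  (Rank : nat -> T -> 'I_N)   (* 0-based rank of the requested content *)
  (Dist : nat -> T -> R)      (* distance of the requester to the SBS *)
  (A : nat -> T -> R)         (* harvested energy A_k *)
  (hBrem_m : forall k (B : set bool), measurable (Brem k @^-1` B))
  (hUrem_m : forall k (B : set 'I_N), measurable (Urem k @^-1` B))
  (hReq_m : forall k (B : set bool), measurable (Req k @^-1` B))
  (hRank_m : forall k (B : set 'I_N), measurable (Rank k @^-1` B))
  (hDist_m : forall k, measurable_fun setT (Dist k))
  (hA_m : forall k, measurable_fun setT (A k))
  (hBrem : forall k, P [set w | Brem k w] = pc%:E)
  (hUrem : forall k (i : 'I_N), P [set w | Urem k w = i] = (N%:R^-1)%:E)
  (hReq : forall k, P [set w | Req k w] = pu%:E)
  (hRank : forall k (i : 'I_N), P [set w | Rank k w = i] = (popularity R N v i)%:E)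
  (hDist : forall k x, 0 <= x <= Rad ->
     P [set w | Dist k w <= x] = (x ^+ 2 / Rad ^+ 2)%:E)
  (hA_nneg : forall k w, 0 <= A k w)
  (hA_id : forall k (B : set R), measurable B ->
     P (A k @^-1` B) = P (A 0%N @^-1` B))
  (hA_int : forall k, P.-integrable setT (EFin \o A k))
  (hA_mean : forall k, ('E_P[A k])%E = Abar%:E)
  (hindep : mutually_independent P (slot_events N Brem Urem Req Rank Dist A))
  (* initial state *)
  (C0 : nat) (E0 : R) (hC0 : (C0 <= N)%N) (hE0 : 0 <= E0)
  (* tilde d *)
  (dt : R)
  (hdt : 0 <= dt <= Rad)
  (hdt_ok : partial_unicast_energy R Eu Rad dt <=
     dtilde_bound R N v pc pu Ep (mean_unicast_energy R Eu Rad) Abar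
       (C_thr_EE R N v pc pu Ep (mean_unicast_energy R Eu Rad)))
  (hdt_max : forall x, 0 <= x <= Rad ->
     partial_unicast_energy R Eu Rad x <=
       dtilde_bound R N v pc pu Ep (mean_unicast_energy R Eu Rad) Abar
         (C_thr_EE R N v pc pu Ep (mean_unicast_energy R Eu Rad)) ->
     x <= dt)
  (* energy condition *)
  (hAbar : pc * (C_thr_EE R N v pc pu Ep (mean_unicast_energy R Eu Rad))%:R * Ep
             / (N%:R + pc) <= Abar) :
  let C := C_thr_EE R N v pc pu Ep (mean_unicast_energy R Eu Rad) in
  let eta := eta_EE R N v pc pu C in
  let blocked k w :=
    eetb_blocked R N C Ep (Eu dt) Eu C0 E0
      (Brem ^~ w) (Urem ^~ w) (Req ^~ w) (Rank ^~ w) (Dist ^~ w) (A ^~ w) k in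
  {ae P, forall w,
    (fun K : nat => K%:R^-1 * \sum_(k < K) (blocked k w)%:R) @ \oo -->
      pc * pu * C%:R / (N%:R + pc) * (1 - pop_head R N v C)
      + eta * ((Rad ^+ 2 - dt ^+ 2) / Rad ^+ 2)}.
Proof.
have [pc0 pc1] := andP hpc; have [pu0 pu1] := andP hpu; have [dt0 dtR] := andP hdt.
set Ebar := mean_unicast_energy R Eu Rad in hdt_ok hdt_max hAbar *.
move=> C eta blocked; rewrite -/C in hdt_ok hdt_max hAbar.
have CN : (C <= N)%N by exact: geq_minl.
pose h := \sum_(i < N | (C <= i)%N) popularity R N v i.
have hE : 1 - pop_head R N v C = h by rewrite /h popularity_tail.
have h0 : 0 <= h by apply: sumr_ge0 => i _; exact: popularity_ge0.
pose m := partial_unicast_energy R Eu Rad dt.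
have m0 : 0 <= m by exact: partial_energy_ge0.
have Ebar0 : 0 <= Ebar by exact: (partial_energy_ge0 hRad hEu_cont hEu_incr hEu_nneg (ltW hRad)).
have N0 : 0 < N%:R :> R by rewrite ltr0n.
have Npc : 0 < N%:R + pc by exact: addr_gt0.
pose pi_ : R := pc * C%:R / (N%:R + pc).
have pi1 : pi_ < 1.
  rewrite /pi_ ltr_pdivrMr // mul1r.
  have : C%:R <= N%:R :> R by rewrite ler_nat.
  have : 0 <= C%:R :> R by []. nra.
have etaE : eta = (1 - pi_) * pu * h by rewrite /eta /eta_EE hE.
have eta0 : 0 <= eta by rewrite etaE !mulr_ge0 // subr_ge0 ltW.
have mEbar : m <= Ebar.
  move: hdt_ok; rewrite -/m /dtilde_bound; case: ifP => // _.
  by rewrite le_min => /andP[].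
have piE : pc * C%:R * Ep / (N%:R + pc) = pi_ * Ep by rewrite /pi_ mulrAC.
(* This is the energy budget of the path argument. For [eta = 0] it reduces to the assumed bound on
   [Abar]; otherwise it is the condition on [dt] multiplied by [eta]. *)
have eta_m : eta * m <= Abar - pi_ * Ep.
  have slack : 0 <= Abar - pi_ * Ep.
    by rewrite subr_ge0 -piE.
  move: hdt_ok; rewrite -/m /dtilde_bound -/eta; case: eqVneq => [->|eta_n0].
    by rewrite mul0r.
  have eta_gt0 : 0 < eta by rewrite lt_neqAle eq_sym eta_n0.
  by rewrite le_min piE => /andP[_]; rewrite ler_pdivlMl // max_r.
have GEp : pu * h * m <= Ep.
  rewrite -hE; apply: le_trans (threshold_energy_le hN hv pc0 pc1 pu0 hEp Ebar0 erefl).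
  by apply: ler_wpM2l => //; rewrite hE mulr_ge0.
(* Outside [0, Rad] nothing is known about [Eu], not even measurability. *)
pose Eum := Eu \_ `[0, Rad].
have EumE x : 0 <= x <= Rad -> Eum x = Eu x.
  by move=> hx; rewrite /Eum patchT // inE /= in_itv.
have Eum_m : measurable_fun setT Eum.
  have mI : measurable (`[0, Rad]%classic : set R) by exact: measurable_itv.
  by apply/(measurable_restrictT _ mI); exact: subspace_continuous_measurable_fun.
have lln_drop g mg := drop_lln Ep hBrem_m hUrem_m hReq_m hRank_m hDist_m hA_m hBrem
  hUrem hindep E0 (Eu dt) CN hC0 Eum_m (g := g) mg.
have lln_req g x hx mg := request_lln Ep hBrem_m hUrem_m hReq_m hRank_m hDist_m hA_m
  hReq hRank hDist hindep C C0 E0 (Eu dt) Eum_m (g := g) (x := x) hx mg.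
have lln_harv := harvest_lln hBrem_m hUrem_m hReq_m hRank_m hDist_m hA_m hA_id
  hindep hA_nneg (hA_int 0) (hA_mean 0).
have ler_m c : measurable_fun setT (fun e : R => c <= e).
  by apply: measurable_fun_ler => //; exact: measurable_cst.
have Rad_in : 0 <= Rad <= Rad by rewrite lexx ltW.
have grid_in n i : 0 <= grid dt n i <= Rad.
  have /andP[g1 g2] := grid_bounds dt0 n i.
  by rewrite g1 (le_trans g2).
have dt_in : 0 <= dt <= Rad by [].
have over_ae := lln_drop (fun c _ => (C < c)%N) (fun=> measurable_cst _).
have under_ae := lln_drop (fun c e => (c.+1 < C)%N && (Ep <= e))
  (fun c => measurable_and (measurable_cst _) (ler_m Ep)).
have all_ae := lln_drop (fun _ _ => true) (fun=> measurable_cst _).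
have push_ae := lln_req (fun c e => (c < C)%N && (Ep <= e)) Rad Rad_in
  (fun c => measurable_and (measurable_cst _) (ler_m Ep)).
have high_ae x hx := lln_req (fun c _ => (C <= c)%N) x hx (fun=> measurable_cst _).
have grid_ae := ae_foralln (fun n => ae_foralln (fun i => high_ae _ (grid_in n i))).
have dist_ae := ae_distance_bounds hRad hDist_m hDist.
have aeI (Q1 Q2 : T -> Prop) : {ae P, forall w, Q1 w} -> {ae P, forall w, Q2 w} ->
    {ae P, forall w, Q1 w /\ Q2 w} by move=> q1 q2; apply: filterS2 q1 q2.
have all_facts := aeI _ _ over_ae (aeI _ _ under_ae (aeI _ _ all_ae (aeI _ _ push_ae
  (aeI _ _ (high_ae Rad Rad_in) (aeI _ _ (high_ae dt dt_in)
  (aeI _ _ grid_ae (aeI _ _ lln_harv dist_ae))))))).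
apply: filterS all_facts => w [[_ over_w] [[under_w _] [[drop_w drop_w'] [[push_w push_w']
  [[high_w high_w'] [[near_w near_w'] [grid_w [harv_w dist_w]]]]]]]].
have dist0 k : 0 < Dist k w by case/andP: (dist_w k).
have distR k : Dist k w <= Rad by case/andP: (dist_w k).
have EuE k : Eu (Dist k w) = Eum (Dist k w) by rewrite EumE // distR ltW.
(* Strict monotonicity turns the energy test of the policy into a distance test, whose probability
   is known. *)
have nearE k : (Eum (Dist k w) <= Eu dt) = (Dist k w <= dt).
  rewrite -EuE; have [le_d|gt_d] := leP (Dist k w) dt.
    exact: (Eu_le hEu_incr (ltW (dist0 k)) le_d dtR).
  apply/negbTE; rewrite -ltNge; apply: hEu_incr => //; rewrite in_itv //=.
  by rewrite distR ltW.
(* At radius [Rad] the distance condition is void, so [request_lln] also counts all requests beyond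
   the first [C] ranks. *)
have askedE k : [&& Req k w, (C <= Rank k w)%N & Dist k w <= Rad] =
    Req k w && (C <= Rank k w)%N by rewrite distR andbT.
have p2R : pu * h * (Rad ^+ 2 / Rad ^+ 2) = pu * h.
  by rewrite divff ?mulr1 // expf_neq0 // gt_eqF.
pose p2 := dt ^+ 2 / Rad ^+ 2.
have blockedE K : \sum_(k < K) (blocked k w)%:R =
    \sum_(k < K) (eetb_blocked R N C Ep (Eu dt) Eum C0 E0
      (Brem ^~ w) (Urem ^~ w) (Req ^~ w) (Rank ^~ w) (Dist ^~ w) (A ^~ w) k)%:R :> R.
  by apply: eq_bigr => k _; congr (_%:R); congr nat_of_bool; exact: eq_eetb_blocked.
under eq_fun do rewrite blockedE.
have -> : pc * pu * C%:R / (N%:R + pc) * (1 - pop_head R N v C) +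
    eta * ((Rad ^+ 2 - dt ^+ 2) / Rad ^+ 2) =
    pi_ * (pu * h) + (1 - pi_) * (pu * h) * (1 - p2).
  rewrite hE etaE /p2 /pi_; field.
  by rewrite !gt_eqF.
pose high k := (C <= (eetb_state R N C Ep (Eu dt) Eum C0 E0
  (Brem ^~ w) (Urem ^~ w) (Req ^~ w) (Rank ^~ w) (Dist ^~ w) (A ^~ w) k).1)%N.
pose asked k := Req k w && (C <= Rank k w)%N.
have puh0 : 0 <= pu * h by exact: mulr_ge0.
have lln_grid n i : negl (fun k => (high k)%:R *
    ((asked k && (Dist k w <= grid dt n i))%:R -
     pu * h * (grid dt n i ^+ 2 / Rad ^+ 2))).
  by apply: negl_le (proj1 (grid_w n i)) => k; rewrite -andbA.
have lln_grid' n i : negl (fun k => (high k)%:R *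
    (pu * h * (grid dt n i ^+ 2 / Rad ^+ 2) -
     (asked k && (Dist k w <= grid dt n i))%:R)).
  by apply: negl_le (proj2 (grid_w n i)) => k; rewrite -andbA.
apply: (@blocking_frequency R N C Ep (Eu dt) Eum C0 E0 _ _ _ _ _ _ hN CN hC0
  _ pc pu h m p2 Abar).
- by move=> k /=; rewrite -EuE; exact: (Eu_gt0 hRad hEu_incr hEu_nneg (dist0 k) (distR k)).
- exact: hpc.
- exact: hEp.
- exact: pu0.
- exact: h0.
- by rewrite divr_ge0 // exprn_ge0 // ltW.
- by rewrite ler_pdivrMr ?exprn_gt0 // mul1r ler_pXn2r // nnegrE ltW.
- by apply: hEu_nneg; rewrite in_itv.
- exact: m0.
- exact: GEp.
- by rewrite -/pi_; move: eta_m; rewrite etaE; lra.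
- exact: over_w.
- exact: under_w.
- by apply: negl_le drop_w => k; rewrite mul1r.
- by apply: negl_le drop_w' => k; rewrite mul1r.
- by apply: negl_le push_w => k; rewrite askedE p2R.
- by apply: negl_le push_w' => k; rewrite askedE p2R.
- by apply: negl_le high_w => k; rewrite askedE p2R.
- by apply: negl_le high_w' => k; rewrite askedE p2R.
- by apply: negl_le near_w => k; rewrite nearE -andbA.
- by apply: negl_le near_w' => k; rewrite nearE -andbA.
- have h1 := negl_unicast_energy hRad hEu_cont hEu_incr hEu_nneg dt0 dtR puh0
    dist0 distR lln_grid lln_grid'.
  by apply: negl_le h1 => k; rewrite nearE -EuE.
- move=> eps eps0.
  have [del del0 h1] := negl_cheap_requests hRad hEu_incr hEu_nneg dt0 dtR puh0
    dist0 distR lln_grid eps0.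
  by exists del => //; apply: negl_le h1 => k; rewrite nearE EuE.
- exact: harv_w.
Qed.
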